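(* Let $Z$ be a $\mathcal{Z}$-valued random variable with probability density $f_\star$ with respect to $dz$, and write $\mathbb{P}_\star,\mathbb{E}_\star$ for probability and expectation under $f_\star$. Let $\theta_\star\in\mathbb{R}^p$, $\theta_\star\neq 0$, let $\delta_\star\in\Delta$ be the support of $\theta_\star$ and $s_\star=\|\theta_\star\|_0$. Let $\bar\rho,\bar\kappa$ be finite positive constants such that $\mathbb{P}_\star(Z\in\mathcal{E}_0)>0$, where $\mathcal{E}_0$ is the set defined in the context, and suppose $32\rho_1\|\theta_\star\|_\infty\le\bar\rho$. Suppose the prior on $\delta$ is $\omega(\delta)=\mathsf{q}^{\|\delta\|_0}(1-\mathsf{q})^{p-\|\delta\|_0}$, $\delta\in\Delta$, where $\mathsf{q}\in(0,1)$ satisfies $\frac{\mathsf{q}}{1-\mathsf{q}}=\frac{1}{p^{u+1}}$ for some absolute constant $u>0$, and that $p\ge 9$ and $p^{u/2}\ge 2e^{2\rho_1}$. Let $\bar s\ge s_\star$ be an arbitrary integer, let $\mathsf{r}$ be a rate function, let $\epsilon$, $\mathsf{B}$, $\mathsf{B}_j$, $\mathcal{E}_2(\bar s)$ be the associated objects defined in the context (with absolute constants $C,C_1\ge3$), and let $\mathcal{E}\subseteq\mathcal{E}_2(\bar s)$ be measurable. Suppose that $$\min_{j:\,\delta_{\star j}=1}|\theta_{\star j}|>C\epsilon .$$ For some constant $\underline{\kappa}>0$, suppose that for all $z\in\mathcal{E}$, $$\min_{\delta\in\mathcal{A}_{\bar s}}\ \inf_{w\in\mathbb{R}^{\|\delta\|_0}:\,\|w-\hat\theta_\delta\|_2\le2\epsilon}\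 \inf\left\{\frac{v'\left(-\nabla^{(2)}\ell^{[\delta]}(w;z)\right)v}{\|v\|_2^2}:\ v\in\mathbb{R}^{\|\delta\|_0},\ v\ne0\right\}\ge\underline{\kappa},$$ and $$\max_{\delta\in\mathcal{A}_{\bar s}}\ \sup_{w\in\mathbb{R}^{\|\delta\|_0}}\ \sup\left\{\frac{v'\left(-\nabla^{(2)}\ell^{[\delta]}(w;z)\right)v}{\|v\|_2^2}:\ v\in\mathbb{R}^{\|\delta\|_0},\ v\ne0\right\}\le\bar\kappa .$$ Then for any $j\ge1$, $$\mathbf{1}_{\mathcal{E}}(z)\left(1-\Pi(\mathsf{B}_j\mid z)\right)\le8\,e^{C_0\left(\rho_1\|\theta_\star\|_\infty\bar s^{1/2}\epsilon+\mathsf{a}_2\bar s^{3/2}\epsilon^3\right)}\,e^{\frac{2\mathsf{a}_2\bar s^3\epsilon}{\underline{\kappa}}}\left(\sqrt{\frac{\rho_1}{\underline{\kappa}}}\,\frac{1}{p^{u/2}}\right)^{j+1}+\mathbf{1}_{\mathcal{E}}(z)\,\Pi(\mathsf{B}^c\mid z),$$ provided that $\underline{\kappa}\,p^u\ge4\rho_1$ and $(C-1)\epsilon\,\underline{\kappa}^{1/2}\ge2(s_\star^{1/2}+1)$, where $\mathsf{a}_2=\max_{\delta\in\mathcal{A}_{\bar s}}\varpi(\delta,(C+1)\epsilon;z)$, $\mathsf{B}^c=(\Delta\times\mathbb{R}^p)\setminus\mathsf{B}$, and $C_0$ is some absolute constant.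
   Context: Setting: $\mathcal{Z}$ is a measurable space with a sigma-finite reference measure $dz$; $\ell:\mathbb{R}^p\times\mathcal{Z}\to\mathbb{R}$ is jointly measurable and thrice differentiable in its first argument for every $z$; $\nabla$, $\nabla^{(2)}$ denote first and second derivatives with respect to the first argument. $\rho_0,\rho_1>0$ are prior parameters. An absolute constant is one that does not depend on $p$. Notation: $\Delta=\{0,1\}^p$; $\theta\cdot\theta'$ is the componentwise product; $\theta_\delta=\theta\cdot\delta$; $\mathbb{R}^p_\delta=\{\theta\cdot\delta:\theta\in\mathbb{R}^p\}$; $\|\cdot\|_0$ is the number of nonzero components; $\Delta_{\bar s}=\{\delta\in\Delta:\|\delta\|_0\le\bar s\}$; $\delta\supseteq\delta'$ means $\delta_j=1$ whenever $\delta'_j=1$. For $w\in\mathbb{R}^{\|\delta\|_0}$, $(w,0)_\delta$ is the element of $\mathbb{R}^p_\delta$ whose components selected by $\delta$, in order, are $w$. Quasi-posterior distribution on $\Delta\times\mathbb{R}^p$: $$\Pi(\delta,d\theta\mid z)\propto e^{\ell(\theta_\delta;z)}\,\omega(\delta)\left(\tfrac{\rho_1}{2\pi}\right)^{\|\delta\|_0/2}\left(\tfrac{\rho_0}{2\pi}\right)^{(p-\|\delta\|_0)/2}e^{-\frac{\rho_1}{2}\|\theta_\delta\|_2^2}e^{-\frac{\rho_0}{2}\|\theta-\theta_\delta\|_2^2}\,d\theta ,$$ well-defined when it can be normalized. $\mathcal{L}_{\theta_1}(\theta;z)=\ell(\theta;z)-\ell(\theta_1;z)-\langle\nabla\ell(\theta_1;z),\theta-\theta_1\rangle$.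 $\mathcal{E}_0=\{z\in\mathcal{Z}:\ \Pi(\cdot\mid z)\text{ is well-defined},\ \|\nabla\ell(\theta_\star;z)\|_\infty\le\bar\rho/2,\ \text{and }\mathcal{L}_{\theta_\star}(\theta;z)\ge-\frac{\bar\kappa}{2}\|\theta-\theta_\star\|_2^2\text{ for all }\theta\in\mathbb{R}^p_{\delta_\star}\}$. A rate function is a continuous increasing function $\mathsf{r}:[0,\infty)\to[0,\infty)$ with $\mathsf{r}(0)=0$ and $\lim_{x\downarrow0}\mathsf{r}(x)/x=0$. Given a rate function $\mathsf{r}$, $$\mathcal{E}_1(\bar s)=\mathcal{E}_0\cap\left\{z\in\mathcal{Z}:\ \mathcal{L}_{\theta_\star}(\theta;z)\le-\tfrac12\mathsf{r}(\|\theta-\theta_\star\|_2)\ \text{for all }\delta\in\Delta_{\bar s},\ \theta\in\mathbb{R}^p_\delta\right\},$$ $$\epsilon=\inf\left\{y>0:\ \mathsf{r}(x)-2(s_\star+\bar s)^{1/2}\bar\rho\,x\ge0\ \text{for all }x\ge y\right\}.$$ For some absolute constants $C,C_1\ge3$: $\mathsf{B}^{(\delta)}=\{\theta\in\mathbb{R}^p:\ \|\theta_\delta-\theta_\star\|_2\le C\epsilon,\ \|\theta-\theta_\delta\|_2\le\sqrt{(1+C_1)\rho_0^{-1}p}\}$ and $\mathsf{B}=\bigcup_{\delta\in\Delta_{\bar s}}\{\delta\}\times\mathsf{B}^{(\delta)}$. For an integer $s\ge s_\star$, $\mathcal{A}_s=\{\delta\in\Delta:\|\delta\|_0\le s,\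 \delta\supseteq\delta_\star\}$; and for $j\ge0$, $\mathsf{B}_j=\bigcup_{\delta\in\mathcal{A}_{s_\star+j}}\{\delta\}\times\mathsf{B}^{(\delta)}$. $\ell^{[\delta]}(w;z)=\ell((w,0)_\delta;z)$ for $w\in\mathbb{R}^{\|\delta\|_0}$; $\hat\theta_\delta=\hat\theta_\delta(z)=\operatorname{argmax}_{w\in\mathbb{R}^{\|\delta\|_0}}\ell^{[\delta]}(w;z)$ (taken to be well-defined for $z\in\mathcal{E}_1(\bar s)$, $\delta\in\Delta_{\bar s}$), and $\hat\theta_\star=\hat\theta_{\delta_\star}$. $$\varpi(\delta,a;z)=\sup_{w\in\mathbb{R}^{\|\delta\|_0}:\,\|w-\hat\theta_\delta\|_2\le a}\ \max_{1\le i,j,k\le\|\delta\|_0}\left|\frac{\partial^3\ell^{[\delta]}(w;z)}{\partial w_i\partial w_j\partial w_k}\right|.$$ $$\mathcal{E}_2(\bar s)=\mathcal{E}_1(\bar s)\cap\bigcap_{j=1}^{\bar s-s_\star}\left\{z\in\mathcal{Z}:\ \max_{\delta\in\mathcal{A}_{\bar s}:\,\|\delta\|_0=s_\star+j}\ell^{[\delta]}(\hat\theta_\delta;z)-\ell^{[\delta_\star]}(\hat\theta_\star;z)\le\frac{ju}{2}\log(p)\right\}.$$ *)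

(* Defs.v *)
From HB Require Import structures.
From mathcomp Require Import all_boot all_order all_algebra.
From mathcomp Require Import all_classical all_reals all_analysis.

Set Implicit Arguments.
Unset Strict Implicit.
Unset Printing Implicit Defensive.

Import Order.TTheory GRing.Theory Num.Theory.
Import numFieldNormedType.Exports.

Local Open Scope classical_set_scope.
Local Open Scope ring_scope.

(* Vectors of R^n are row vectors ['rV[R]_n]; their canonical norm [`|x|] is
   the sup-norm. An element of {0,1}^p is encoded by the set of the indices of
   its components equal to 1, hence ||delta||_0 is [#|delta|]. *)

Section lebesgue_tuple.
Context {R : realType}.
Local Notation rT := (measurableTypeR R).

Definition tcons n (x : rT * n.-tuple rT) : n.+1.-tuple rT :=
  [tuple of x.1 :: x.2].

Lemma measurable_tcons n : measurable_fun [set: rT * n.-tuple rT] (@tcons n).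
Proof.
by apply: measurable_cons; [exact: measurable_fst|exact: measurable_snd].
Qed.

Section step.
Variables (n : nat) (m : {sigma_finite_measure set (n.-tuple rT) -> \bar R}).

Definition lebesgue_cons : set (n.+1.-tuple rT) -> \bar R :=
  pushforward (lebesgue_measure \x m)%E (@tcons n).

Let mu0 : lebesgue_cons set0 = 0%E.
Proof. by rewrite /lebesgue_cons /pushforward preimage_set0 measure0. Qed.

Let mu_ge0 A : (0 <= lebesgue_cons A)%E.
Proof. exact: (measure_ge0 (lebesgue_measure \x m)%E (@tcons n @^-1` A)). Qed.

Let mu_additive : semi_sigma_additive lebesgue_cons.
Proof.
move=> F mF tF mUF; rewrite /lebesgue_cons /pushforward preimage_bigcup.
have mpre A : measurable A -> measurable (@tcons n @^-1` A).
  by move=> mA; rewrite -[X in measurable X]setTI; exact: measurable_tcons.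
apply: measure_semi_sigma_additive.
- by move=> k; exact: mpre.
- apply/trivIsetP => /= i j _ _ ij; rewrite -preimage_setI.
  by move/trivIsetP : tF => /(_ _ _ _ _ ij) ->//; rewrite preimage_set0.
- by rewrite -preimage_bigcup; exact: mpre.
Qed.

HB.instance Definition _ :=
  isMeasure.Build _ _ _ lebesgue_cons mu0 mu_ge0 mu_additive.

Let mu_sigma_finite : sigma_finite setT lebesgue_cons.
Proof.
have /sigma_finiteP[F [FT ndF Foo]] := sigma_finiteT (@lebesgue_measure R).
have /sigma_finiteP[G [GT ndG Goo]] := sigma_finiteT m.
pose dec (t : n.+1.-tuple rT) : rT * n.-tuple rT :=
  (tnth t ord0, [tuple of behead t]).
have mdec : measurable_fun setT dec.
  by apply/measurable_fun_pair;
    [exact: measurable_tnth|exact: measurable_behead].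
have decK x : dec (tcons x) = x.
  by case: x => x t; congr pair => //; apply/val_inj.
exists (fun k => dec @^-1` (F k `*` G k)).
  rewrite -preimage_bigcup (_ : \bigcup_k (F k `*` G k) = setT) ?preimage_setT//.
  rewrite -subTset => -[x t] _.
  have [i _ Fx] : (\bigcup_i F i) x by rewrite -FT.
  have [j _ Gt] : (\bigcup_i G i) t by rewrite -GT.
  exists (maxn i j) => //; split => /=.
    by apply: (subsetPset _ _ (ndF _ _ (leq_maxl i j))).
  by apply: (subsetPset _ _ (ndG _ _ (leq_maxr i j))).
move=> k; have [mF Fk] := Foo k; have [mG Gk] := Goo k; split.
  by rewrite -[X in measurable X]setTI; apply: mdec => //; exact: measurableX.
rewrite /lebesgue_cons /pushforward -comp_preimage.
rewrite (_ : dec \o _ = id); last exact/funext.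
by rewrite preimage_id product_measure1E// lte_mul_pinfty// ge0_fin_numE.
Qed.

HB.instance Definition _ :=
  Measure_isSigmaFinite.Build _ _ _ lebesgue_cons mu_sigma_finite.

End step.

(* Lebesgue measure on R^n. *)
Fixpoint lebesgue_tuple n : {sigma_finite_measure set (n.-tuple rT) -> \bar R} :=
  match n with
  | 0 => \d_([tuple] : 0.-tuple rT)
  | k.+1 => lebesgue_cons (lebesgue_tuple k)
  end.

Lemma lebesgue_tuple_box n (A : 'I_n -> set rT) :
  (forall i, measurable (A i)) ->
  lebesgue_tuple n [set t | forall i, A i (tnth t i)] =
  (\prod_(i < n) lebesgue_measure (A i))%E.
Proof.
elim: n A => [|n IH] A mA.
  rewrite big_ord0 /= diracE mem_set //= => -[].
  by [].
rewrite big_ord_recl -IH//= /lebesgue_cons /pushforward.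
rewrite -product_measure1E//; last first.
  have -> : [set t : n.-tuple rT | forall i, A (lift ord0 i) (tnth t i)] =
     \bigcap_(i in [set: 'I_n]) (fun t => tnth t i) @^-1` A (lift ord0 i).
    by apply/seteqP; split => t /= h i *; exact: h.
  apply: fin_bigcap_measurable => [|i _]; first exact: finite_finset.
  by rewrite -[X in measurable X]setTI; exact: measurable_tnth.
congr (product_measure1 _ _ _); apply/seteqP; split => -[x t] /=.
  move=> h; split; first exact: (h ord0).
  by move=> i; have := h (lift ord0 i); rewrite /tcons /= tnthS.
move=> [h0 h] i; case: (unliftP ord0 i) => [j ->|-> //].
by rewrite /tcons/= tnthS.
Qed.

Definition tuple_rV n (t : n.-tuple rT) : 'rV[R]_n := \row_i tnth t i.

End lebesgue_tuple.

Section euclidean.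
Context {R : realType} {n : nat}.
Implicit Types (x y : 'rV[R]_n) (f : 'rV[R]_n -> R).

Definition dotv x y : R := \sum_i x 0 i * y 0 i.

Definition norm2 x : R := Num.sqrt (dotv x x).

Definition partial (i : 'I_n) f : 'rV[R]_n -> R := 'D_(delta_mx 0 i) f.

Definition grad f x : 'rV[R]_n := \row_i partial i f x.

Definition hess f x : 'M[R]_n := \matrix_(i, j) partial i (partial j f) x.

Definition quadf (M : 'M[R]_n) x : R := (x *m M *m x^T) 0 0.

(* In finite dimension, f is k.+1 times (Frechet) differentiable iff f is
   differentiable and its directional derivatives are k times
   differentiable. *)
Fixpoint times_differentiable k f : Prop :=
  if k is k'.+1 then
    (forall x, differentiable f x) /\
    (forall v, times_differentiable k' ('D_v f))
  else True.

Definition is_argmax f x : Prop := forall y, f y <= f x.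

End euclidean.

(* "Increasing" is understood in the wide sense; strictly increasing functions
   are included. *)
Definition rate_function {R : realType} (r : R -> R) : Prop :=
  [/\ {in `[0, +oo[, forall x, 0 <= r x},
      {within `[0, +oo[, continuous r},
      {in `[0, +oo[ &, {homo r : x y / x <= y}},
      r 0 = 0 &
      r x / x @[x --> 0^'+] --> 0].

Section sparse.
Context {R : realType} {p : nat}.
Implicit Types (theta : 'rV[R]_p) (delta : {set 'I_p}).

Definition restr delta theta : 'rV[R]_p := \row_i (theta 0 i *+ (i \in delta)).

Definition supp theta : {set 'I_p} := [set i | theta 0 i != 0]%SET.

Definition models (s : nat) : set {set 'I_p} := [set delta | (#|delta| <= s)%N].

Definition supermodels theta (s : nat) : set {set 'I_p} :=
  [set delta | (#|delta| <= s)%N /\ supp theta \subset delta].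

(* (w, 0)_delta; [enum_val] enumerates delta in increasing order. *)
Definition embed delta (w : 'rV[R]_#|delta|) : 'rV[R]_p :=
  \sum_(k < #|delta|) w 0 k *: delta_mx 0 (enum_val k).

Definition bernoulli_prior (q : R) delta : R :=
  q ^+ #|delta| * (1 - q) ^+ (p - #|delta|).

End sparse.

Section quasi_posterior.
Context {R : realType} {p : nat} {Z : Type}.
Variables (rho0 rho1 : R) (omega : {set 'I_p} -> R) (ell : 'rV[R]_p -> Z -> R).
Implicit Types (theta : 'rV[R]_p) (delta : {set 'I_p}) (z : Z).

Definition qp_density z delta theta : R :=
  expR (ell (restr delta theta) z) * omega delta *
  (rho1 / (2 * pi)) `^ (#|delta|%:R / 2) *
  (rho0 / (2 * pi)) `^ ((p - #|delta|)%:R / 2) *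
  expR (- (rho1 / 2 * norm2 (restr delta theta) ^+ 2)) *
  expR (- (rho0 / 2 * norm2 (theta - restr delta theta) ^+ 2)).

Definition qp_mass z (A : set ({set 'I_p} * 'rV[R]_p)) : \bar R :=
  (\sum_(delta : {set 'I_p})
    \int[lebesgue_tuple p]_(t in [set t | A (delta, tuple_rV t)])
      (qp_density z delta (tuple_rV t))%:E)%E.

Definition qp_well_defined z : Prop := (0 < qp_mass z setT < +oo)%E.

(* Only meaningful when [qp_well_defined z]. *)
Definition quasi_post z (A : set ({set 'I_p} * 'rV[R]_p)) : R :=
  fine (qp_mass z A) / fine (qp_mass z setT).

End quasi_posterior.

Section events.
Context {R : realType} {p : nat} {Z : Type}.
Variables (rho0 rho1 : R) (omega : {set 'I_p} -> R) (ell : 'rV[R]_p -> Z -> R).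
Variables (thetas : 'rV[R]_p) (rhobar kappabar : R).
Implicit Types (theta : 'rV[R]_p) (delta : {set 'I_p}) (z : Z).

Definition bregman theta1 theta z : R :=
  ell theta z - ell theta1 z - dotv (grad (ell ^~ z) theta1) (theta - theta1).

Definition event0 : set Z :=
  [set z | [/\ qp_well_defined rho0 rho1 omega ell z,
      `|grad (ell ^~ z) thetas| <= rhobar / 2 &
      forall theta, range (restr (supp thetas)) theta ->
        - (kappabar / 2 * norm2 (theta - thetas) ^+ 2) <=
        bregman thetas theta z]].

Variables (r : R -> R) (sbar : nat).

Definition event1 : set Z := event0 `&`
  [set z | forall delta theta, models sbar delta -> range (restr delta) theta ->
    bregman thetas theta z <= - (2^-1 * r (norm2 (theta - thetas)))].

(* Equal to +oo when no y is admissible. *)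
Definition rate_eps : \bar R :=
  ereal_inf [set y%:E | y in [set y : R | 0 < y /\ forall x, y <= x ->
    0 <= r x - 2 * Num.sqrt (#|supp thetas| + sbar)%:R * rhobar * x]].

Variables (u : R) (thetahat : forall delta, Z -> 'rV[R]_#|delta|).

Definition ellsub delta (w : 'rV[R]_#|delta|) z : R := ell (embed w) z.

Definition event2 : set Z := event1 `&`
  \bigcap_(j in [set j | (1 <= j <= sbar - #|supp thetas|)%N])
    [set z | forall delta, supermodels thetas sbar delta ->
      #|delta| = (#|supp thetas| + j)%N ->
      ellsub (thetahat delta z) z - ellsub (thetahat (supp thetas) z) z <=
      j%:R * u / 2 * ln p%:R].

(* Extended real: third derivatives need not be bounded on the ball. *)
Definition varpi delta (a : R) z : \bar R :=
  ereal_sup [set `|partial ijk.1.1 (partial ijk.1.2 (partial ijk.2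
                    (fun w : 'rV[R]_#|delta| => ellsub w z))) w|%:E
    | ijk in [set: 'I_#|delta| * 'I_#|delta| * 'I_#|delta|] &
      w in [set w : 'rV[R]_#|delta| | norm2 (w - thetahat delta z) <= a]].

Definition a2 (a : R) z : \bar R :=
  ereal_sup [set varpi delta a z | delta in supermodels thetas sbar].

End events.

Section balls.
Context {R : realType} {p : nat}.
Variables (rho0 : R) (thetas : 'rV[R]_p) (C C1 eps : R).
Implicit Types (delta : {set 'I_p}).

Definition Bmodel delta : set 'rV[R]_p :=
  [set theta | norm2 (restr delta theta - thetas) <= C * eps /\
    norm2 (theta - restr delta theta) <=
    Num.sqrt ((1 + C1) * rho0^-1 * p%:R)].

Definition Ball (sbar : nat) : set ({set 'I_p} * 'rV[R]_p) :=
  \bigcup_(delta in models sbar) ([set delta] `*` Bmodel delta).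

Definition Bsup (j : nat) : set ({set 'I_p} * 'rV[R]_p) :=
  \bigcup_(delta in supermodels thetas (#|supp thetas| + j))
    ([set delta] `*` Bmodel delta).

End balls.

(* Main.v *)
Require Import Defs.
From HB Require Import structures.
From mathcomp Require Import all_boot all_order all_algebra.
From mathcomp Require Import all_classical all_reals all_analysis.
From mathcomp Require Import measurable_realfun lra.
Import Order.TTheory GRing.Theory Num.Theory.
Import numFieldNormedType.Exports.
Local Open Scope classical_set_scope.
Local Open Scope ring_scope.

Set Implicit Arguments.
Unset Strict Implicit.
Unset Printing Implicit Defensive.

(** The complement of [Bsup j] consists of the complement of [Ball] and of models
    [delta] in [Ball] that are not in [Bsup j]. Since every nonzero component of
    [thetas] exceeds [C * eps], each such [delta] contains the support [S] of
    [thetas], with [k > j] excess coordinates. So it is enough to bound the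
    posterior mass of a supermodel [delta] within the ball around [thetas] by a
    small multiple of the mass of the true model [S], and to sum over [delta].

    The maximizers of the log-likelihood on [delta] and on [S] are both within
    [eps] of [thetas] ([maximizer_near_truth]), and around each of them the
    log-likelihood is quadratic up to a cubic error controlled by its third
    derivatives ([quadratic_expansion]), while the Gaussian slab is nearly constant
    ([sqr_norm2_near]). The mass of [delta] is thus bounded by a Gaussian integral
    ([integral_qp_density_le]), and that of [S] from below by a Gaussian integral
    over a ball ([integral_qp_density_ge]), which by Chernoff's bound is at least
    half of the full integral ([gauss_ball]).

    The Gaussian integrals are compared without determinants, by changes of
    variables on the whole space, where the unselected coordinates carry their own
    Gaussian factor. Completing the square ([complete_square]) and a shear decouple
    the [k] excess coordinates, on which the remaining quadratic form is at least
    [kappa] times the squared norm, so that they contribute at most the factor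
    [sqrt (rho0 / kappa) ^+ k] ([gauss_integrate_out]). The two remaining integrals
    over the coordinates in [S] have as precision matrices the Hessians at two
    points at distance at most [2 * eps]; a bound on the third derivatives makes
    them comparable ([hess_compare]), and rescaling the coordinates turns this into
    a comparison of the integrals ([gauss_compare]). This gives the second
    exponential factor of the bound, and the cubic errors and the variation of the
    slab give the first one ([total_error_le]).

    Finally the prior odds [p ^ -(u + 1)] of each excess coordinate, the gain in
    log-likelihood, at most [u / 2 * ln p] for each of them, and the Gaussian factor
    leave [p^-1 * (sqrt (rho1 / kappa) * p ^ (- u / 2))] for each excess coordinate
    ([qp_weight_ratio], [model_ratio_le]). The factors [p^-1] are summable over the
    supermodels of [S], with a sum at most [(1 + p^-1) ^+ p <= expR 1]
    ([sum_supermodels_le]); the other factors, at least [j + 1] in number, give the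
    last factor of the bound. *)

(** * Affine changes of variables for Lebesgue measure on tuples *)

Section change_of_variables.
Context {R : realType}.
Local Notation rT := (measurableTypeR R).
Local Notation mu := (@lebesgue_measure R).
Local Open Scope ereal_scope.

(** Lebesgue measure on the line is characterized by the lengths of half-open
    intervals, and the image of an interval under an affine map of slope [c]
    shows the factor [c^-1]. *)
Lemma ge0_integral_affine (f : rT -> \bar R) (c b : R) : (0 < c)%R ->
  measurable_fun [set: rT] f -> (forall x, 0 <= f x) ->
  \int[mu]_x f (c * x + b)%R = (c^-1)%:E * \int[mu]_x f x.
Proof.
move=> c0 mf f0.
pose phi : rT -> rT := fun x => (c * x + b)%R.
have mphi : measurable_fun [set: rT] phi.
  by apply: measurable_funD => //; exact: measurable_funM.
pose nu_ := mscale (NngNum (ltW c0)) (pushforward mu phi)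
  : {measure set rT -> \bar R}.
pose nu := nu_ mphi.
have nuE A : measurable A -> mu A = nu A.
  apply: lebesgue_measure_unique => _ [[x y]] _ <- /=.
  rewrite /nu /nu_ /mscale /= /pushforward.
  have -> : phi @^-1` `]x, y]%classic = `]((x - b) / c)%R, ((y - b) / c)%R]%classic.
    by apply/seteqP; split => t /=; rewrite !in_itv/= /phi
      ltr_pdivrMr// ler_pdivlMr// ltrBlDr lerBrDr mulrC.
  rewrite !lebesgue_measure_itv/= !lte_fin ltr_pM2r ?invr_gt0// ltrD2r.
  case: ifPn => _; rewrite ?mule0// -!EFinB -EFinM; congr EFin.
  rewrite -mulrBl (_ : y - b - (x - b) = y - x)%R; last lra.
  by rewrite mulrC divfK ?gt_eqF.
rewrite [in RHS](eq_measure_integral nu); last by move=> A mA _; exact: nuE.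
rewrite ge0_integral_mscale//= muleA -EFinM mulVf ?gt_eqF// mul1e.
by rewrite ge0_integral_pushforward.
Qed.

Lemma measurable_fun_tcons n x :
  measurable_fun [set: n.-tuple rT] (fun t : n.-tuple rT => tcons (x, t)).
Proof. exact: (measurableT_comp (@measurable_tcons R n)). Qed.

Lemma measurable_fun_tcons1 n (t : n.-tuple rT) :
  measurable_fun [set: rT] (fun x : rT => tcons (x, t)).
Proof. exact: (measurableT_comp (@measurable_tcons R n)). Qed.

Lemma ge0_integral_tcons n (f : n.+1.-tuple rT -> \bar R) :
  measurable_fun setT f -> (forall t, 0 <= f t) ->
  \int[lebesgue_tuple n.+1]_t f t =
  \int[mu]_x \int[lebesgue_tuple n]_t f (tcons (x, t)).
Proof.
move=> mf f0; rewrite /= ge0_integral_pushforward//; last exact: measurable_tcons.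
rewrite preimage_setT fubini_tonelli1//.
  by apply: measurableT_comp mf _; exact: measurable_tcons.
by move=> t; exact: f0.
Qed.

Lemma ge0_integral_tconsC n (f : n.+1.-tuple rT -> \bar R) :
  measurable_fun setT f -> (forall t, 0 <= f t) ->
  \int[lebesgue_tuple n.+1]_t f t =
  \int[lebesgue_tuple n]_t \int[mu]_x f (tcons (x, t)).
Proof.
move=> mf f0; rewrite /= ge0_integral_pushforward//; last exact: measurable_tcons.
have mft : measurable_fun setT (f \o @tcons R n).
  by apply: measurableT_comp mf _; exact: measurable_tcons.
by rewrite preimage_setT fubini_tonelli1 ?fubini_tonelli//= => t; exact: f0.
Qed.

(** Translations, diagonal scalings and shears all have this form; the lemmas
    below ask that the shifts [g k] do not depend on the coordinates in [S],
    which makes the change of variables triangular. *)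
Definition affine_at n (S : {set 'I_n}) (c : 'I_n -> R)
    (g : 'I_n -> n.-tuple rT -> R) (t : n.-tuple rT) : n.-tuple rT :=
  [tuple if k \in S then c k * tnth t k + g k t else tnth t k | k < n]%R.

Lemma measurable_affine_at n S c g : (forall k, measurable_fun setT (g k)) ->
  measurable_fun setT (@affine_at n S c g).
Proof.
move=> mg; apply/measurable_fun_tnthP => k.
apply: (eq_measurable_fun (fun t => if k \in S then c k * tnth t k + g k t else tnth t k)%R).
  by move=> t _; rewrite /= tnth_mktuple.
case: (k \in S); last exact: measurable_tnth.
have mt : measurable_fun [set: n.-tuple rT] (fun t : n.-tuple rT => (tnth t k : R)).
  exact: measurable_tnth.
exact: (measurable_funD (measurable_funM (measurable_cst (c k)) mt) (mg k)).
Qed.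

(** By Tonelli's theorem the changed coordinate may be integrated first. If it is
    the head of the tuple, the one-dimensional rule applies for a fixed tail;
    otherwise the statement for the tail applies for a fixed head. *)
Lemma ge0_integral_affine1 n (i : 'I_n) (c : 'I_n -> R)
    (g : 'I_n -> n.-tuple rT -> R) (f : n.-tuple rT -> \bar R) :
  (0 < c i)%R -> (forall k, measurable_fun setT (g k)) ->
  (forall t t', (forall k, k != i -> tnth t k = tnth t' k) -> g i t = g i t') ->
  measurable_fun setT f -> (forall t, 0 <= f t) ->
  \int[lebesgue_tuple n]_t f (affine_at [set i] c g t) =
  ((c i)^-1)%:E * \int[lebesgue_tuple n]_t f t.
Proof.
elim: n => [|n IH] in i c g f *; first by case: i.
move=> c0 mg gi mf f0.
have mfT : measurable_fun setT (fun t => f (affine_at [set i] c g t)).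
  by apply: measurableT_comp mf _; exact: measurable_affine_at.
have mft : measurable_fun setT (f \o @tcons R n).
  by apply: measurableT_comp mf _; exact: measurable_tcons.
have [j ij|i0] := unliftP ord0 i.
- rewrite !ge0_integral_tcons//.
  pose c' k := c (lift ord0 k).
  pose g' x k t := g (lift ord0 k) (tcons (x, t)).
  have E x t : affine_at [set i] c g (tcons (x, t)) =
               tcons (x, affine_at [set j] c' (g' x) t).
    apply: eq_from_tnth => k; rewrite tnth_mktuple !inE ij.
    have [l ->|->] := unliftP ord0 k.
      by rewrite (inj_eq lift_inj) /tcons/= !tnthS tnth_mktuple inE.
    by rewrite (negbTE (neq_lift _ _)).
  have IHx x : \int[lebesgue_tuple n]_t f (affine_at [set i] c g (tcons (x, t))) =
       ((c i)^-1)%:E * \int[lebesgue_tuple n]_t f (tcons (x, t)).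
    under eq_integral do rewrite E.
    rewrite (IH j c' (g' x) (fun t => f (tcons (x, t))))//.
    + by rewrite /c' -ij.
    + by rewrite /c' -ij.
    + by move=> k; apply: measurableT_comp (mg _) _; exact: measurable_fun_tcons.
    + move=> t t' tt'; rewrite /g' -ij; apply: gi => k.
      have [l ->|-> //] := unliftP ord0 k.
      by rewrite ij (inj_eq lift_inj) /tcons/= !tnthS; exact: tt'.
    + by apply: measurableT_comp mf _; exact: measurable_fun_tcons.
  under eq_integral do rewrite IHx.
  rewrite ge0_integralZl//.
  + exact: (@measurable_fun_fubini_tonelli_F _ _ _ _ _ (lebesgue_tuple n) _ mft (fun t => f0 _)).
  + by move=> x _; exact: integral_ge0.
  + by rewrite lee_fin invr_ge0 ltW.
- rewrite !ge0_integral_tconsC//.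
  have E x t : affine_at [set i] c g (tcons (x, t)) =
               tcons (c i * x + g i (tcons (0%R : rT, t)), t)%R.
    apply: eq_from_tnth => k; rewrite tnth_mktuple inE i0.
    have [l ->|->] := unliftP ord0 k.
      by rewrite eq_sym (negbTE (neq_lift _ _)) /tcons/= !tnthS.
    rewrite eqxx; congr (_ * _ + _)%R; rewrite -i0; apply: gi => l.
    by rewrite i0; have [m ->|->] := unliftP ord0 l; rewrite ?eqxx// /tcons/= !tnthS.
  under eq_integral => t _.
    under eq_integral do rewrite E.
    rewrite (@ge0_integral_affine (fun x => f (tcons (x, t))))//; last first.
      by apply: measurableT_comp mf _; exact: measurable_fun_tcons1.
    over.
  rewrite ge0_integralZl//.
  + exact: (@measurable_fun_fubini_tonelli_G _ _ _ _ _ mu _ mft (fun t => f0 _)).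
  + by move=> x _; exact: integral_ge0.
  + by rewrite lee_fin invr_ge0 ltW.
Qed.

(** The change of variables is a composition of changes of one coordinate: since
    no shift sees a coordinate in [S], the order of the factors is immaterial. *)
Lemma ge0_integral_affine_at n (S : {set 'I_n}) (c : 'I_n -> R)
    (g : 'I_n -> n.-tuple rT -> R) (f : n.-tuple rT -> \bar R) :
  (forall i, i \in S -> 0 < c i)%R -> (forall k, measurable_fun setT (g k)) ->
  (forall i t t', i \in S ->
    (forall k, k \notin S -> tnth t k = tnth t' k) -> g i t = g i t') ->
  measurable_fun setT f -> (forall t, 0 <= f t) ->
  \int[lebesgue_tuple n]_t f (affine_at S c g t) =
  (\prod_(i in S) (c i)^-1)%:E * \int[lebesgue_tuple n]_t f t.
Proof.
move: {2}#|S| (erefl #|S|) => m; elim: m => [|m IH] in S f *.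
  move/eqP; rewrite cards_eq0 => /eqP -> _ _ _ mf f0; rewrite big_set0 mul1e.
  apply: eq_integral => t _; congr f; apply: eq_from_tnth => k.
  by rewrite tnth_mktuple inE.
move=> Sm c0 mg gS mf f0.
have [i iS] : exists i, i \in S by apply/set0Pn; rewrite -cards_eq0 Sm.
pose S' := (S :\ i)%SET.
have E t : affine_at S c g t = affine_at S' c g (affine_at [set i] c g t).
  apply: eq_from_tnth => k; rewrite !tnth_mktuple !inE.
  have [->|ki] /= := eqVneq k i; first by rewrite iS.
  case: ifPn => // kS; congr (_ + _)%R; apply: gS => // l lS.
  rewrite tnth_mktuple inE; case: eqP => // li; by rewrite li iS in lS.
under eq_integral do rewrite E.
rewrite (@ge0_integral_affine1 n i c g (fun t => f (affine_at S' c g t)))//.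
- rewrite IH//.
  + by rewrite (big_setD1 i iS)/= EFinM muleA.
  + by move: Sm; rewrite (cardsD1 i) iS => -[].
  + by move=> k; rewrite inE => /andP[_]; exact: c0.
  + move=> k t t'; rewrite inE => /andP[_ kS] H; apply: gS => // l lS.
    by apply: H; rewrite inE negb_and lS orbT.
- exact: c0.
- move=> t t' H; apply: gS => // k kS; apply: H.
  by apply: contraNneq kS => ->.
- by apply: measurableT_comp mf _; exact: measurable_affine_at.
Qed.

End change_of_variables.

(** * Euclidean norms, sparse vectors and quadratic forms *)

Section vectors.
Context {R : realType} {p : nat}.
Implicit Types (x y v w : 'rV[R]_p) (S T : {set 'I_p}) (M : 'M[R]_p).

Lemma norm2_ge0 n (x : 'rV[R]_n) : 0 <= norm2 x.
Proof. exact: sqrtr_ge0. Qed.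

Lemma sqr_norm2 n (x : 'rV[R]_n) : norm2 x ^+ 2 = \sum_i x 0 i ^+ 2.
Proof.
rewrite sqr_sqrtr; first by apply: eq_bigr => i _; rewrite expr2.
by apply: sumr_ge0 => i _; rewrite -expr2 sqr_ge0.
Qed.

Lemma ler_norm2 n m (x : 'rV[R]_n) (y : 'rV[R]_m) :
  norm2 x ^+ 2 <= norm2 y ^+ 2 -> norm2 x <= norm2 y.
Proof. by rewrite ler_pXn2r// nnegrE norm2_ge0. Qed.

Lemma norm2_eq0 n (x : 'rV[R]_n) : (norm2 x == 0) = (x == 0).
Proof.
rewrite -(sqrf_eq0 (norm2 x)) sqr_norm2 psumr_eq0; last by move=> i _; rewrite sqr_ge0.
apply/allP/eqP => [h|-> i _]; last by rewrite mxE expr0n eqxx implybT.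
apply/rowP => i; rewrite mxE; apply/eqP; rewrite -sqrf_eq0.
by apply: (h i); rewrite mem_index_enum.
Qed.

Lemma ler_coord_norm2 n (x : 'rV[R]_n) i : `|x 0 i| <= norm2 x.
Proof.
rewrite -(ler_pXn2r (n := 2%N))// ?nnegrE ?norm2_ge0// real_normK ?num_real//.
by rewrite sqr_norm2 (bigD1 i)//= lerDl sumr_ge0// => j _; rewrite sqr_ge0.
Qed.

(** Cauchy-Schwarz, by expanding the squared norm of
    [norm2 y *: x - norm2 x *: y]. *)
Lemma ler_dotv_norm2 n (x y : 'rV[R]_n) : dotv x y <= norm2 x * norm2 y.
Proof.
have [->|x0] := eqVneq x 0.
  rewrite (_ : dotv _ _ = 0) ?mulr_ge0 ?norm2_ge0//.
  by rewrite /dotv big1// => i _; rewrite mxE mul0r.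
have [->|y0] := eqVneq y 0.
  rewrite (_ : dotv _ _ = 0) ?mulr_ge0 ?norm2_ge0//.
  by rewrite /dotv big1// => i _; rewrite mxE mulr0.
have a0 : 0 < norm2 x by rewrite lt_neqAle norm2_ge0 eq_sym norm2_eq0 x0.
have b0 : 0 < norm2 y by rewrite lt_neqAle norm2_ge0 eq_sym norm2_eq0 y0.
set a := norm2 x; set b := norm2 y.
have : 0 <= \sum_i (b * x 0 i - a * y 0 i) ^+ 2.
  by apply: sumr_ge0 => i _; rewrite sqr_ge0.
have -> : \sum_i (b * x 0 i - a * y 0 i) ^+ 2 =
    \sum_i (b ^+ 2 * x 0 i ^+ 2 + a ^+ 2 * y 0 i ^+ 2 - (2 * a * b) * (x 0 i * y 0 i)).
  by apply: eq_bigr => i _; lra.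
rewrite sumrB big_split/= -!mulr_sumr -!sqr_norm2 -/a -/b -/(dotv x y) => h.
have ab : 0 < 2 * a * b by rewrite !mulr_gt0.
by rewrite -(ler_pM2l ab); lra.
Qed.

Lemma ler_norm2D n (x y : 'rV[R]_n) : norm2 (x + y) <= norm2 x + norm2 y.
Proof.
rewrite -(ler_pXn2r (n := 2%N))// ?nnegrE ?addr_ge0 ?norm2_ge0//.
have -> : norm2 (x + y) ^+ 2 = norm2 x ^+ 2 + norm2 y ^+ 2 + 2 * dotv x y.
  rewrite !sqr_norm2 /dotv mulr_sumr -!big_split/=; apply: eq_bigr => i _.
  by rewrite mxE; lra.
by have := ler_dotv_norm2 x y; lra.
Qed.

Lemma norm2Z n (c : R) (x : 'rV[R]_n) : norm2 (c *: x) = `|c| * norm2 x.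
Proof.
apply/eqP; rewrite -(eqrXn2 (n := 2%N))// ?mulr_ge0 ?norm2_ge0//.
rewrite exprMn real_normK ?num_real// !sqr_norm2 mulr_sumr; apply/eqP.
by apply: eq_bigr => i _; rewrite mxE exprMn.
Qed.

Lemma norm2N n (x : 'rV[R]_n) : norm2 (- x) = norm2 x.
Proof. by rewrite -scaleN1r norm2Z normrN1 mul1r. Qed.

Definition norm1 n (x : 'rV[R]_n) : R := \sum_i `|x 0 i|.

Lemma norm1_ge0 n (x : 'rV[R]_n) : 0 <= norm1 x.
Proof. exact: sumr_ge0. Qed.

(** The restriction to the coordinates in [S] is the orthogonal projection
    with matrix [projmx S]; both descriptions are used. *)
Definition projmx S : 'M[R]_p := diag_mx (\row_i (i \in S)%:R).

Lemma restrE S x : restr S x = x *m projmx S.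
Proof.
by apply/rowP => i; rewrite mul_mx_diag !mxE; case: (i \in S); rewrite ?mulr1 ?mulr0.
Qed.

Lemma restrEx S x i : restr S x 0 i = if i \in S then x 0 i else 0.
Proof. by rewrite mxE; case: (i \in S). Qed.

Lemma restrD S x y : restr S (x + y) = restr S x + restr S y.
Proof. by rewrite !restrE mulmxDl. Qed.

Lemma restrB S x y : restr S (x - y) = restr S x - restr S y.
Proof. by rewrite !restrE mulmxBl. Qed.

Lemma restrZ S (c : R) x : restr S (c *: x) = c *: restr S x.
Proof. by rewrite !restrE scalemxAl. Qed.

Lemma restrI S T x : restr S (restr T x) = restr (S :&: T)%SET x.
Proof.
by apply/rowP => i; rewrite !restrEx inE; case: (i \in S) => //=; case: (i \in T).
Qed.

Lemma restr_sub S T x : S \subset T -> restr S (restr T x) = restr S x.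
Proof. by move=> /finset.setIidPl ST; rewrite restrI ST. Qed.

Lemma restr_sub' S T x : S \subset T -> restr T (restr S x) = restr S x.
Proof. by move=> /finset.setIidPr ST; rewrite restrI ST. Qed.

Lemma restrK S x : restr S (restr S x) = restr S x.
Proof. exact: restr_sub. Qed.

Lemma sqr_norm2_restr S x : norm2 (restr S x) ^+ 2 = \sum_(i in S) x 0 i ^+ 2.
Proof.
rewrite sqr_norm2 [RHS]big_mkcond; apply: eq_bigr => i _.
by rewrite restrEx; case: ifP => //; rewrite expr0n.
Qed.

Lemma sqr_norm2_restrC S x :
  norm2 (x - restr S x) ^+ 2 = \sum_(i in ~: S) x 0 i ^+ 2.
Proof.
rewrite sqr_norm2 [RHS]big_mkcond; apply: eq_bigr => i _.
rewrite inE mxE [(- restr _ _) _ _]mxE restrEx; case: ifP => _ /=.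
  by rewrite subrr expr0n.
by rewrite subr0.
Qed.

Lemma norm2_restr_le S x : norm2 (restr S x) <= norm2 x.
Proof.
apply: ler_norm2; rewrite sqr_norm2_restr sqr_norm2 [leRHS](bigID (mem S))/=.
by rewrite lerDl sumr_ge0// => i _; rewrite sqr_ge0.
Qed.

(** Cauchy-Schwarz against the indicator of [S]. *)
Lemma norm1_restr S x : norm1 (restr S x) <= Num.sqrt #|S|%:R * norm2 (restr S x).
Proof.
pose a : 'rV[R]_p := \row_i `|restr S x 0 i|.
pose b : 'rV[R]_p := \row_i (i \in S)%:R.
have <- : dotv b a = norm1 (restr S x).
  apply: eq_bigr => i _; rewrite !mxE.
  by case: (i \in S); rewrite ?mul1r// mulr0n normr0 mulr0.
apply: (le_trans (ler_dotv_norm2 _ _)).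
suff -> : norm2 b = Num.sqrt #|S|%:R.
  suff -> : norm2 a = norm2 (restr S x) by [].
  congr Num.sqrt; apply: eq_bigr => i _.
  by rewrite -!expr2 !mxE real_normK ?num_real.
congr Num.sqrt; rewrite -sum1_card natr_sum [RHS]big_mkcond; apply: eq_bigr => i _.
by rewrite mxE; case: (i \in S); rewrite ?mulr1 ?mulr0.
Qed.

Lemma ler_coord_norm x i : `|x 0 i| <= `|x|.
Proof.
rewrite [leRHS]mx_normrE.
exact: (le_bigmax_cond 0 (fun ij : 'I_1 * 'I_p => `|x ij.1 ij.2|) (j := (0, i))).
Qed.

End vectors.

Section quadratic_forms.
Context {R : realType} {p : nat}.
Implicit Types (x y v w : 'rV[R]_p) (S T : {set 'I_p}) (M : 'M[R]_p).

Definition bilf M x y : R := (x *m M *m y^T) 0 0.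

Lemma bilfDl M x y v : bilf M (x + y) v = bilf M x v + bilf M y v.
Proof. by rewrite /bilf !mulmxDl mxE. Qed.

Lemma bilfDr M x y v : bilf M v (x + y) = bilf M v x + bilf M v y.
Proof. by rewrite /bilf linearD/= mulmxDr mxE. Qed.

Lemma bilfBl M x y v : bilf M (x - y) v = bilf M x v - bilf M y v.
Proof. by rewrite /bilf !mulmxBl [LHS]mxE [X in _ + X]mxE. Qed.

Lemma bilfT M x y : bilf M^T x y = bilf M y x.
Proof.
rewrite /bilf; transitivity ((x *m M^T *m y^T)^T 0 0); first by rewrite [RHS]mxE.
by rewrite !trmx_mul !trmxK mulmxA.
Qed.

Lemma bilfDm M1 M2 x y : bilf (M1 + M2) x y = bilf M1 x y + bilf M2 x y.
Proof. by rewrite /bilf mulmxDr mulmxDl mxE. Qed.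

Lemma quadfZ M (c : R) x : quadf M (c *: x) = c ^+ 2 * quadf M x.
Proof. by rewrite /quadf linearZ/= -scalemxAr -!scalemxAl !mxE mulrA expr2. Qed.

Lemma quadfE M x : quadf M x = \sum_i \sum_j x 0 i * M i j * x 0 j.
Proof.
rewrite /quadf mxE exchange_big/=; apply: eq_bigr => j _.
by rewrite !mxE mulr_suml; apply: eq_bigr => i _.
Qed.

(** Completing the square: minimising a coercive quadratic form over the block
    [S] is done by a linear function of the other coordinates, and what remains
    after this minimisation is at least as coercive as the form itself. *)
Lemma complete_square S T M (k : R) : 0 < k -> S \subset T ->
  (forall v, k * norm2 (restr T v) ^+ 2 <= quadf M (restr T v)) ->
  exists A : 'M[R]_p, (forall x, restr S (x *m A) = x *m A) /\
    forall x, quadf M (restr S x + restr (T :\: S) x *m A) +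
              k * norm2 (restr (T :\: S) x) ^+ 2 <= quadf M (restr T x).
Proof.
move=> k0 ST hM.
(* [W] is the compression of [N] to the block [S], completed by the identity; the
   minimizer over the block solves a linear system of matrix [W] *)
pose N := M + M^T; pose P : 'M[R]_p := projmx S; pose W := P *m N *m P + (1%:M - P).
have PT : P^T = P by exact: tr_diag_mx.
have PP : P *m P = P.
  rewrite mulmx_diag; congr diag_mx; apply/rowP => i; rewrite !mxE.
  by case: (i \in S); rewrite ?mulr1 ?mulr0.
have PC : P *m (1%:M - P) = 0 by rewrite mulmxBr mulmx1 PP subrr.
have bilN x y : bilf N x y = bilf M x y + bilf M y x by rewrite bilfDm bilfT.
have quadD x y : quadf M (x + y) = quadf M x + quadf M y + bilf N x y.
  by rewrite bilN -[LHS]/(bilf _ _ _) bilfDl !bilfDr -![quadf _ _]/(bilf _ _ _); lra.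
have Wu : W \in unitmx.
  rewrite -row_free_unit -kermx_eq0; apply/negPn/negP => /rowV0Pn[x].
  move/sub_kermxP => xW x0.
  have : (x *m W *m x^T) 0 0 = 0 by rewrite xW mul0mx mxE.
  have -> : (x *m W *m x^T) 0 0 = 2 * quadf M (restr S x) + norm2 (x - restr S x) ^+ 2.
    rewrite mulmxDr mulmxDl mxE; congr (_ + _).
      transitivity (bilf N (restr S x) (restr S x)).
        by rewrite /bilf restrE -/P trmx_mul PT !mulmxA.
      by rewrite bilN -[quadf _ _]/(bilf _ _ _); lra.
    rewrite sqr_norm2_restrC mulmxBr mulmx1 -restrE mxE [RHS]big_mkcond.
    apply: eq_bigr => i _; rewrite !mxE inE; case: (i \in S) => /=.
      by rewrite subrr mul0r.
    by rewrite subr0 expr2.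
  have := hM (restr S x); rewrite restr_sub'// => h1 h2.
  have n1 : 0 <= norm2 (restr S x) ^+ 2 by rewrite sqr_ge0.
  have n2 : 0 <= norm2 (x - restr S x) ^+ 2 by rewrite sqr_ge0.
  have n3 : 0 <= k * norm2 (restr S x) ^+ 2 by rewrite mulr_ge0// ltW.
  have q0 : quadf M (restr S x) = 0 by lra.
  have r0 : norm2 (x - restr S x) ^+ 2 = 0 by lra.
  have s0 : norm2 (restr S x) ^+ 2 = 0.
    by apply/eqP; rewrite -(mulrI_eq0 _ (lregP (lt0r_neq0 k0))); apply/eqP; lra.
  move: r0 s0 => /eqP; rewrite sqrf_eq0 norm2_eq0 => /eqP r0 /eqP.
  rewrite sqrf_eq0 norm2_eq0 => /eqP s0.
  by move: x0; rewrite -(subrK (restr S x) x) r0 s0 addr0 eqxx.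
pose A := N *m P *m invmx W.
have AW : A *m W = N *m P by rewrite /A mulmxKV.
have AP : A *m P = A.
  have : A *m (1%:M - P) = A *m W *m (1%:M - P).
    rewrite -mulmxA; congr (_ *m _).
    rewrite mulmxDl -!mulmxA PC !mulmx0 add0r mulmxBl mul1mx PC.
    by rewrite subr0.
  rewrite AW -mulmxA PC mulmx0 mulmxBr mulmx1 => /eqP.
  by rewrite subr_eq0 => /eqP.
have xAS x : restr S (x *m A) = x *m A by rewrite restrE -mulmxA AP.
exists A; split => // x.
set v2 := restr (T :\: S) x; set l := v2 *m A.
have lS : restr S l = l by exact: xAS.
have lP : l *m P = l by rewrite -restrE xAS.
have lC : l *m (1%:M - P) = 0 by rewrite -lP -mulmxA PC mulmx0.
(* the residual of the minimizer is orthogonal to the block, so the cross term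
   vanishes *)
have ortho y : bilf N l (restr S y) = bilf N v2 (restr S y).
  have E w : bilf N w (restr S y) = (w *m N *m P *m (restr S y)^T) 0 0.
    by rewrite /bilf restrE -/P trmx_mul PT -!mulmxA !(mulmxA P) PP.
  rewrite !E; congr ((_ *m _) 0 0).
  rewrite -[RHS]mulmxA -AW mulmxA -/l /W mulmxDr lC addr0.
  by rewrite !mulmxA lP.
have -> : restr T x = (restr S x + l) + (v2 - l).
  rewrite addrACA subrr addr0; apply/rowP => i; rewrite !mxE inE.
  have := fintype.subsetP ST i; case: (i \in S) => /= [->//|_]; rewrite ?addr0//.
  by rewrite add0r.
rewrite [leRHS]quadD -addrA lerD2l.
have -> : bilf N (restr S x + l) (v2 - l) = 0.
  have -> : restr S x + l = restr S (x + l) by rewrite restrD xAS.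
  by rewrite bilN addrC -bilN bilfBl ortho subrr.
rewrite addr0.
have v2l : restr T (v2 - l) = v2 - l.
  rewrite restrB restrI; congr (_ - _).
    by congr (restr _ _); apply/finset.setIidPr; exact: finset.subsetDl.
  by rewrite -lS restr_sub'.
rewrite -v2l; apply: le_trans (hM _); rewrite v2l ler_wpM2l ?(ltW k0)//.
rewrite [leRHS]sqr_norm2 sqr_norm2_restr [leLHS]big_mkcond; apply: ler_sum => i _.
rewrite mxE [(- l) _ _]mxE -lS !restrEx inE; case: (i \in S) => /=.
  by rewrite sqr_ge0.
by case: (i \in T) => /=; rewrite ?subr0// sqr_ge0.
Qed.

End quadratic_forms.

(** * Measurability and integration of functions of a vector *)

Section integrals_over_vectors.
Context {R : realType} {p : nat}.
Local Notation rT := (measurableTypeR R).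
Implicit Types (f g : 'rV[R]_p -> R) (S T : {set 'I_p}) (x y : 'rV[R]_p).

(** Lebesgue measure lives on tuples while the calculus is done on row vectors:
    measurability and integrals of functions of a row vector are read through
    [tuple_rV]. *)
Definition measurable_rV f : Prop :=
  measurable_fun [set: p.-tuple rT] (fun t : p.-tuple rT => f (tuple_rV t)).

Definition integral_rV f : \bar R :=
  (\int[lebesgue_tuple p]_t (f (tuple_rV t))%:E)%E.

Lemma eq_measurable_rV f g : f =1 g -> measurable_rV f -> measurable_rV g.
Proof. by move=> /funext ->. Qed.

Lemma measurable_rV_cst (c : R) : measurable_rV (fun=> c).
Proof. exact: measurable_cst. Qed.

Lemma measurable_rV_coord i : measurable_rV (fun x => x 0 i).
Proof.
rewrite /measurable_rV; under eq_fun do rewrite mxE; exact: measurable_tnth.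
Qed.

Lemma measurable_rVD f g : measurable_rV f -> measurable_rV g ->
  measurable_rV (fun x => f x + g x).
Proof. exact: measurable_funD. Qed.

Lemma measurable_rVB f g : measurable_rV f -> measurable_rV g ->
  measurable_rV (fun x => f x - g x).
Proof. exact: measurable_funB. Qed.

Lemma measurable_rVM f g : measurable_rV f -> measurable_rV g ->
  measurable_rV (fun x => f x * g x).
Proof. exact: measurable_funM. Qed.

Lemma measurable_rVN f : measurable_rV f -> measurable_rV (fun x => - f x).
Proof.
move=> mf; apply: (eq_measurable_rV (f := fun x => 0 - f x)).
  by move=> x; rewrite sub0r.
by apply: measurable_rVB => //; exact: measurable_rV_cst.
Qed.

Lemma measurable_rV_sum (I : Type) (s : seq I) (P : pred I)
    (F : I -> 'rV[R]_p -> R) :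
  (forall i, measurable_rV (F i)) ->
  measurable_rV (fun x => \sum_(i <- s | P i) F i x).
Proof.
move=> mF; elim: s => [|i s IH].
  apply: (eq_measurable_rV (f := fun=> 0)); last exact: measurable_rV_cst.
  by move=> x; rewrite big_nil.
have mFi : measurable_rV (fun x => F i x + \sum_(i <- s | P i) F i x).
  exact: measurable_rVD.
case Pi : (P i).
  by apply: eq_measurable_rV mFi => x; rewrite big_cons Pi.
by apply: eq_measurable_rV IH => x; rewrite big_cons Pi.
Qed.

Lemma measurable_rV_expR f : measurable_rV f -> measurable_rV (fun x => expR (f x)).
Proof. by move=> mf; apply: measurableT_comp mf; exact: measurable_expR. Qed.

Lemma measurable_rV_exprn f n : measurable_rV f -> measurable_rV (fun x => f x ^+ n).
Proof.
move=> mf; elim: n => [|n IH]; first exact: measurable_rV_cst.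
by apply: (eq_measurable_rV (f := fun x => f x * f x ^+ n)) => [x|];
  rewrite ?exprS//; exact: measurable_rVM.
Qed.

Lemma measurable_rV_mulmx (M : 'M[R]_p) (h : 'rV[R]_p -> 'rV[R]_p) k :
  (forall i, measurable_rV (fun x => h x 0 i)) ->
  measurable_rV (fun x => (h x *m M) 0 k).
Proof.
move=> mh; apply: (eq_measurable_rV (f := fun x => \sum_j h x 0 j * M j k)).
  by move=> x; rewrite mxE.
by apply: measurable_rV_sum => j; apply: measurable_rVM => //; exact: measurable_rV_cst.
Qed.

Lemma measurable_rV_restr S (h : 'rV[R]_p -> 'rV[R]_p) k :
  (forall i, measurable_rV (fun x => h x 0 i)) ->
  measurable_rV (fun x => restr S (h x) 0 k).
Proof.
move=> mh; case kS : (k \in S).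
  by apply: eq_measurable_rV (mh k) => x; rewrite restrEx kS.
apply: eq_measurable_rV (measurable_rV_cst 0) => x; by rewrite restrEx kS.
Qed.

Lemma measurable_rV_addv (h1 h2 : 'rV[R]_p -> 'rV[R]_p) k :
  (forall i, measurable_rV (fun x => h1 x 0 i)) ->
  (forall i, measurable_rV (fun x => h2 x 0 i)) ->
  measurable_rV (fun x => (h1 x + h2 x) 0 k).
Proof.
move=> m1 m2; apply: (eq_measurable_rV (f := fun x => h1 x 0 k + h2 x 0 k)).
  by move=> x; rewrite [RHS]mxE.
exact: measurable_rVD.
Qed.

Lemma measurable_rV_subv (h1 h2 : 'rV[R]_p -> 'rV[R]_p) k :
  (forall i, measurable_rV (fun x => h1 x 0 i)) ->
  (forall i, measurable_rV (fun x => h2 x 0 i)) ->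
  measurable_rV (fun x => (h1 x - h2 x) 0 k).
Proof.
move=> m1 m2; apply: (eq_measurable_rV (f := fun x => h1 x 0 k - h2 x 0 k)).
  by move=> x; rewrite !mxE.
exact: measurable_rVB.
Qed.

Lemma measurable_rV_quadf (M : 'M[R]_p) (h : 'rV[R]_p -> 'rV[R]_p) :
  (forall i, measurable_rV (fun x => h x 0 i)) ->
  measurable_rV (fun x => quadf M (h x)).
Proof.
move=> mh.
apply: (eq_measurable_rV (f := fun x => \sum_i \sum_j h x 0 i * M i j * h x 0 j)).
  by move=> x; rewrite quadfE.
apply: measurable_rV_sum => i; apply: measurable_rV_sum => j.
apply: measurable_rVM => //; apply: measurable_rVM => //; exact: measurable_rV_cst.
Qed.

Lemma measurable_rV_sqr_norm2 (h : 'rV[R]_p -> 'rV[R]_p) :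
  (forall i, measurable_rV (fun x => h x 0 i)) ->
  measurable_rV (fun x => norm2 (h x) ^+ 2).
Proof.
move=> mh; apply: (eq_measurable_rV (f := fun x => \sum_i h x 0 i ^+ 2)).
  by move=> x; rewrite sqr_norm2.
by apply: measurable_rV_sum => i; exact: measurable_rV_exprn.
Qed.

Lemma measurable_rV_ler f g : measurable_rV f -> measurable_rV g ->
  measurable_rV (fun x => (f x <= g x)%R%:R).
Proof.
move=> mf mg.
have m1 : measurable_fun [set: bool] (fun b : bool => b%:R : R) by [].
by apply: measurableT_comp m1 _; exact: measurable_fun_ler.
Qed.

Lemma integral_rV_ge0 f : (forall x, 0 <= f x) -> (0 <= integral_rV f)%E.
Proof. by move=> f0; apply: integral_ge0 => t _; rewrite lee_fin. Qed.

Lemma le_integral_rV f g : (forall x, 0 <= f x) -> (forall x, f x <= g x) ->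
  measurable_rV f -> measurable_rV g -> (integral_rV f <= integral_rV g)%E.
Proof.
move=> f0 fg mf mg; apply: ge0_le_integral => //=.
- by move=> t _; rewrite lee_fin.
- exact/measurable_EFinP.
- exact/measurable_EFinP.
- by move=> t _; rewrite lee_fin.
Qed.

Lemma integral_rVZl (c : R) f : 0 <= c -> (forall x, 0 <= f x) -> measurable_rV f ->
  integral_rV (fun x => c * f x) = (c%:E * integral_rV f)%E.
Proof.
move=> c0 f0 mf; rewrite /integral_rV; under eq_integral do rewrite EFinM.
rewrite ge0_integralZl//; last by move=> t _; rewrite lee_fin.
exact/measurable_EFinP.
Qed.

Lemma integral_rVD f g : (forall x, 0 <= f x) -> (forall x, 0 <= g x) ->
  measurable_rV f -> measurable_rV g ->
  integral_rV (fun x => f x + g x) = (integral_rV f + integral_rV g)%E.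
Proof.
move=> f0 g0 mf mg; rewrite /integral_rV; under eq_integral do rewrite EFinD.
rewrite ge0_integralD//.
- by move=> t _; rewrite lee_fin.
- exact/measurable_EFinP.
- by move=> t _; rewrite lee_fin.
- exact/measurable_EFinP.
Qed.

Definition affine_rV S (c : 'I_p -> R) (g : 'rV[R]_p -> 'rV[R]_p) x : 'rV[R]_p :=
  \row_k if k \in S then c k * x 0 k + g x 0 k else x 0 k.

Lemma integral_rV_affine S (c : 'I_p -> R) (g : 'rV[R]_p -> 'rV[R]_p) f :
  (forall k, k \in S -> 0 < c k) ->
  (forall k, measurable_rV (fun x => g x 0 k)) ->
  (forall k x y, k \in S -> (forall l, l \notin S -> x 0 l = y 0 l) ->
     g x 0 k = g y 0 k) ->
  measurable_rV f -> (forall x, 0 <= f x) ->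
  integral_rV (f \o affine_rV S c g) =
  ((\prod_(k in S) (c k)^-1)%:E * integral_rV f)%E.
Proof.
move=> c0 mg gS mf f0.
rewrite -(@ge0_integral_affine_at _ _ S c (fun k t => g (tuple_rV t) 0 k)
  (fun t => (f (tuple_rV t))%:E))//.
- rewrite /integral_rV; apply: eq_integral => t _; congr (f _)%:E.
  by apply/rowP => k; rewrite !mxE tnth_mktuple.
- by move=> k t t' kS h; apply: gS => // l lS; rewrite !mxE; exact: h.
- exact/measurable_EFinP.
- by move=> t; rewrite lee_fin.
Qed.

Lemma integral_rV_shift f h : measurable_rV f -> (forall x, 0 <= f x) ->
  integral_rV (fun x => f (x + h)) = integral_rV f.
Proof.
move=> mf f0; have := @integral_rV_affine [set: 'I_p]%SET (fun=> 1) (fun=> h) f.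
rewrite big1 ?mul1e; last by move=> *; rewrite invr1.
move=> <-//; first by congr integral_rV; apply/funext => x /=; congr f;
  apply/rowP => k; rewrite !mxE inE mul1r.
by move=> k; exact: measurable_rV_cst.
Qed.

(** Rescaling the block of coordinates in [S] only. On quadratic forms of that
    block it acts by the factor [c ^+ 2], so that Gaussian integrals with
    proportional precision matrices are related without being computed. *)
Definition scale_at S (c : R) x : 'rV[R]_p := c *: restr S x + (x - restr S x).

Lemma restr_scale_at S c x : restr S (scale_at S c x) = c *: restr S x.
Proof. by rewrite restrD restrZ restrB restrK subrr addr0. Qed.

Lemma restrC_scale_at S c x :
  scale_at S c x - restr S (scale_at S c x) = x - restr S x.
Proof. by rewrite restr_scale_at addrC addKr. Qed.

Lemma integral_rV_scale_at S (c : R) f : 0 < c ->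
  measurable_rV f -> (forall x, 0 <= f x) ->
  integral_rV (fun x => f (scale_at S c x)) = ((c^-1 ^+ #|S|)%:E * integral_rV f)%E.
Proof.
move=> c0 mf f0; have := @integral_rV_affine S (fun=> c) (fun=> 0) f.
rewrite prodr_const => <-//.
- congr integral_rV; apply/funext => x /=; congr f; apply/rowP => k.
  rewrite !mxE; case: (k \in S); first by rewrite mulr1n addr0 subrr addr0.
  by rewrite mulr0n mulr0 add0r subr0.
- by move=> k; exact: measurable_rV_cst.
Qed.

End integrals_over_vectors.

Section product_integral.
Context {R : realType}.
Local Notation rT := (measurableTypeR R).
Local Open Scope ereal_scope.

Lemma integral_prod_lty (g : rT -> R) n : measurable_fun [set: rT] g ->
  (forall x, 0 <= g x)%R -> \int[lebesgue_measure]_x (g x)%:E < +oo ->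
  \int[lebesgue_tuple n]_t (\prod_(i < n) g (tnth t i))%:E < +oo.
Proof.
move=> mg g0 goo.
have mprod m : measurable_fun [set: m.-tuple rT] (fun t => \prod_(i < m) g (tnth t i))%R.
  by apply: measurable_prod => i _; apply: (measurableT_comp mg); exact: measurable_tnth.
have mprodE m : measurable_fun [set: m.-tuple rT] (fun t => (\prod_(i < m) g (tnth t i))%:E).
  by apply/measurable_EFinP; exact: mprod.
have prod0 m (t : m.-tuple rT) : 0 <= (\prod_(i < m) g (tnth t i))%:E.
  by rewrite lee_fin prodr_ge0.
elim: n => [|n IH].
  rewrite /= integral_dirac//=; last exact: mprodE.
  by rewrite big_ord0 mule1 diracE ltry.
rewrite ge0_integral_tcons//.
have IH0 : 0 <= \int[lebesgue_tuple n]_t (\prod_(i < n) g (tnth t i))%:E.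
  by apply: integral_ge0.
under eq_integral => x _.
  under eq_integral => t _.
    rewrite big_ord_recl /= (_ : tnth (tcons (x, t)) ord0 = x)//.
    under eq_bigr do rewrite /tcons/= tnthS.
    rewrite EFinM; over.
  rewrite ge0_integralZl//; [|exact: mprodE|by move=> *; exact: prod0|by rewrite lee_fin].
  rewrite muleC; over.
rewrite ge0_integralZl//.
- by rewrite lte_mul_pinfty// ge0_fin_numE.
- exact/measurable_EFinP.
- by move=> x _; rewrite lee_fin.
Qed.

Lemma integral_expR_sqr_lty (c : R) : (0 < c)%R ->
  \int[lebesgue_measure]_x (expR (- (c * x ^+ 2)))%:E < +oo.
Proof.
move=> c0; have := @ge0_integral_affine R (fun x => (gauss_fun x)%:E) (Num.sqrt c) 0.
rewrite integralT_gauss sqrtr_gt0 => /(_ c0) h.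
under eq_integral => x _.
  rewrite (_ : expR _ = gauss_fun (Num.sqrt c * x + 0)); last first.
    by rewrite /gauss_fun addr0 exprMn sqr_sqrtr// ltW.
  over.
rewrite h ?ltry//.
- by apply/measurable_EFinP; exact: measurable_gauss_fun.
- by move=> x; rewrite lee_fin gauss_fun_ge0.
Qed.

End product_integral.

(** * Comparison of Gaussian integrals *)

Section gaussian_integrals.
Context {R : realType} {p : nat}.
Implicit Types (x y v w h : 'rV[R]_p) (S T U : {set 'I_p}) (M : 'M[R]_p).

Definition coercive S M (k : R) : Prop :=
  forall v, k * norm2 (restr S v) ^+ 2 <= quadf M (restr S v).

(** The unnormalized density of a Gaussian vector with precision matrix [M] on
    the coordinates in [S] and independent coordinates of precision [rho]
    elsewhere. *)
Definition gauss S M (rho : R) y : R :=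
  expR (- (quadf M (restr S y) / 2) - rho / 2 * norm2 (y - restr S y) ^+ 2).

Lemma gauss_ge0 S M rho y : 0 <= gauss S M rho y.
Proof. exact: expR_ge0. Qed.

Lemma measurable_rV_gauss S M rho : measurable_rV (gauss S M rho).
Proof.
have mx i : measurable_rV (fun x : 'rV[R]_p => x 0 i) by exact: measurable_rV_coord.
apply: measurable_rV_expR; apply: measurable_rVB.
  apply: measurable_rVN; apply: measurable_rVM; last exact: measurable_rV_cst.
  by apply: measurable_rV_quadf => i; exact: measurable_rV_restr.
apply: measurable_rVM; first exact: measurable_rV_cst.
apply: measurable_rV_sqr_norm2 => i; apply: measurable_rV_subv => // j.
exact: measurable_rV_restr.
Qed.

Lemma sqr_norm2_split S x :
  norm2 x ^+ 2 = norm2 (restr S x) ^+ 2 + norm2 (x - restr S x) ^+ 2.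
Proof.
rewrite sqr_norm2_restr sqr_norm2_restrC sqr_norm2 (bigID (mem S))/=.
by congr (_ + _); apply: eq_bigl => i; rewrite inE.
Qed.

(** Coercivity dominates the Gaussian density by a product of one-dimensional
    ones. *)
Lemma gauss_lty S M (k rho : R) : 0 < k -> 0 < rho -> coercive S M k ->
  (integral_rV (gauss S M rho) < +oo)%E.
Proof.
move=> k0 rho0 hM.
pose c := Num.min k rho / 2.
have c0 : 0 < c by rewrite divr_gt0// lt_min k0.
have ck : c <= k / 2 by rewrite ler_pM2r ?invr_gt0// ge_min lexx.
have cr : c <= rho / 2 by rewrite ler_pM2r ?invr_gt0// ge_min lexx orbT.
pose g y := \prod_(i < p) expR (- (c * y 0 i ^+ 2)).
have mg : measurable_rV g.
  apply: (eq_measurable_rV (f := fun y => expR (- (c * norm2 y ^+ 2)))).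
    move=> y; rewrite /g -expR_sum sqr_norm2 mulr_sumr -sumrN.
    by [].
  apply: measurable_rV_expR; apply: measurable_rVN.
  apply: measurable_rVM; first exact: measurable_rV_cst.
  by apply: measurable_rV_sqr_norm2 => i; exact: measurable_rV_coord.
have gg y : gauss S M rho y <= g y.
  rewrite /gauss /g -expR_sum ler_expR sumrN -mulr_sumr -sqr_norm2.
  rewrite [norm2 y ^+ 2](sqr_norm2_split S).
  have := hM y; set a := norm2 _ ^+ 2; set b := norm2 _ ^+ 2 => hMy.
  have a0 : 0 <= a by exact: sqr_ge0.
  have b0 : 0 <= b by exact: sqr_ge0.
  have := ler_wpM2r a0 ck; have := ler_wpM2r b0 cr; lra.
apply: (le_lt_trans (le_integral_rV (gauss_ge0 S M rho) gg _ mg)).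
  exact: measurable_rV_gauss.
rewrite /integral_rV /g.
have h := @integral_prod_lty R (fun a : R => expR (- (c * a ^+ 2))) p.
apply: (le_lt_trans _ (h _ _ (integral_expR_sqr_lty c0))) => [||x].
- rewrite le_eqVlt; apply/orP; left; apply/eqP; apply: eq_integral => t _.
  by congr EFin; apply: eq_bigr => i _; rewrite mxE.
- apply: measurableT_comp => //; apply: measurableT_comp => //.
  exact: measurable_funM.
- exact: expR_ge0.
Qed.

Lemma integral_gauss_fin_num S M (k rho : R) : 0 < k -> 0 < rho -> coercive S M k ->
  integral_rV (gauss S M rho) \is a fin_num.
Proof.
move=> k0 rho0 hM; rewrite ge0_fin_numE; first exact: gauss_lty k0 rho0 hM.
by apply: integral_rV_ge0; exact: gauss_ge0.
Qed.

(** Chernoff's bound: the moment generating function of the quadratic form is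
    obtained by rescaling the coordinates in [S], here by the factor sqrt 2. *)
Lemma gauss_ball S M (k rho r : R) : 0 < k -> 0 < rho -> coercive S M k ->
  0 <= r -> 4 * (#|S|%:R + 1) <= k * r ^+ 2 ->
  (integral_rV (gauss S M rho) <= 2%:E *
   integral_rV (fun y => (norm2 (restr S y) <= r)%R%:R * gauss S M rho y)%R)%E.
Proof.
move=> k0 rho0 hM r0 hr.
have c0 : 0 < Num.sqrt 2 :> R by rewrite sqrtr_gt0.
pose G := gauss S M rho.
pose H y := (norm2 (restr S y) <= r)%R%:R * G y.
pose F y := G (scale_at S (Num.sqrt 2)^-1 y).
have FE y : F y = expR (- (quadf M (restr S y) / 4) - rho / 2 * norm2 (y - restr S y) ^+ 2).
  rewrite /F /G /gauss restrC_scale_at restr_scale_at quadfZ exprVn sqr_sqrtr//.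
  by congr expR; lra.
have mG : measurable_rV G by exact: measurable_rV_gauss.
have mx i : measurable_rV (fun x : 'rV[R]_p => x 0 i) by exact: measurable_rV_coord.
have mF : measurable_rV F.
  apply: (eq_measurable_rV (fun y => esym (FE y))).
  apply: measurable_rV_expR; apply: measurable_rVB.
    apply: measurable_rVN; apply: measurable_rVM; last exact: measurable_rV_cst.
    by apply: measurable_rV_quadf => i; exact: measurable_rV_restr.
  apply: measurable_rVM; first exact: measurable_rV_cst.
  apply: measurable_rV_sqr_norm2 => i; apply: measurable_rV_subv => // j.
  exact: measurable_rV_restr.
have mH : measurable_rV H.
  apply: measurable_rVM => //.
  apply: (eq_measurable_rV (f := fun y => (norm2 (restr S y) ^+ 2 <= r ^+ 2)%R%:R)).
    by move=> y; rewrite ler_pXn2r// nnegrE norm2_ge0.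
  apply: measurable_rV_ler; last exact: measurable_rV_cst.
  by apply: measurable_rV_sqr_norm2 => i; exact: measurable_rV_restr.
have G0 y : 0 <= G y by exact: gauss_ge0.
have H0 y : 0 <= H y by apply: mulr_ge0.
have F0 y : 0 <= F y by exact: G0.
have GE y : G y = expR (- (quadf M (restr S y) / 2) - rho / 2 * norm2 (y - restr S y) ^+ 2)
  := erefl _.
have HE y : H y = (norm2 (restr S y) <= r)%R%:R * G y := erefl _.
have IF : integral_rV F = ((Num.sqrt 2 ^+ #|S|)%:E * integral_rV G)%E.
  have c1 : 0 < (Num.sqrt 2)^-1 :> R by rewrite invr_gt0.
  have := integral_rV_scale_at S c1 mG G0; rewrite invrK; exact.
have Gfin : integral_rV G \is a fin_num by exact: integral_gauss_fin_num hM.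
rewrite -/G -/H; clearbody F G H.
pose e : R := expR (- (k * r ^+ 2 / 4)).
have GHF y : G y <= H y + e * F y.
  rewrite HE; case: (leP (norm2 (restr S y)) r) => yr.
    by rewrite mul1r lerDl mulr_ge0// expR_ge0.
  rewrite mul0r add0r FE GE /e -expRD ler_expR.
  have := hM y.
  have : r ^+ 2 <= norm2 (restr S y) ^+ 2.
    by rewrite ler_pXn2r ?nnegrE ?norm2_ge0// ltW.
  by move=> /(ler_wpM2l (ltW k0)); lra.
(* [e <= expR (- #|S| - 1)] by the hypothesis on [r], and [sqrt 2 <= expR 1] *)
have eS : e * Num.sqrt 2 ^+ #|S| <= 2^-1.
  have e1 : 2 <= expR 1 :> R by have := expR_ge1Dx (1 : R); lra.
  have s2 : Num.sqrt 2 <= expR 1 :> R.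
    apply: le_trans e1; rewrite -[leRHS]ger0_norm// -sqrtr_sqr ler_wsqrtr//.
    by rewrite expr2; lra.
  have : e <= expR (- (#|S|%:R + 1)) by rewrite ler_expR; lra.
  have h1 : Num.sqrt 2 ^+ #|S| <= expR #|S|%:R :> R.
    by rewrite -[X in expR X]mulr1 expRM_natl lerXn2r ?nnegrE ?expR_ge0// ltW.
  have s0 : 0 <= Num.sqrt 2 ^+ #|S| :> R by rewrite exprn_ge0// ltW.
  move=> h2; apply: (le_trans (ler_pM (expR_ge0 _) s0 h2 h1)).
  by rewrite -expRD opprD addrAC addNr add0r expRN lef_pV2 ?posrE ?expR_gt0.
have IG : (integral_rV G <= integral_rV H + (e * Num.sqrt 2 ^+ #|S|)%:E * integral_rV G)%E.
  rewrite EFinM -muleA -IF -integral_rVZl ?expR_ge0//.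
  rewrite -integral_rVD//.
  - apply: le_integral_rV => //.
    by apply: measurable_rVD => //; apply: measurable_rVM => //; exact: measurable_rV_cst.
  - by move=> y; rewrite mulr_ge0// expR_ge0.
  - by apply: measurable_rVM => //; exact: measurable_rV_cst.
have I0 : (0 <= integral_rV G)%E by exact: integral_rV_ge0.
have HG : (integral_rV H <= integral_rV G)%E.
  apply: le_integral_rV => // y; rewrite HE.
  by case: (norm2 _ <= r)%R; rewrite ?mul1r// mul0r.
have Hfin : integral_rV H \is a fin_num.
  rewrite ge0_fin_numE ?integral_rV_ge0//; apply: (le_lt_trans HG).
  by rewrite ltey_eq Gfin.
move: IG I0; rewrite -(fineK Gfin) -(fineK Hfin).
rewrite -!EFinM -EFinD !lee_fin => IG I0.
by have := ler_wpM2r I0 eS; lra.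
Qed.

(** Rescaling the coordinates in [S] by [sqrt (1 + t)] turns [M1] into
    [(1 + t) * M1], which dominates [M2]; the Jacobian [(1 + t) ^ (#|S| / 2)] plays
    the role of the square root of a ratio of determinants. *)
Lemma gauss_compare S M1 M2 (t rho : R) : 0 <= t ->
  (forall y, quadf M2 (restr S y) <= (1 + t) * quadf M1 (restr S y)) ->
  (integral_rV (gauss S M1 rho) <=
   (expR (#|S|%:R * t / 2))%:E * integral_rV (gauss S M2 rho))%E.
Proof.
move=> t0 h12.
have t1 : 0 < 1 + t by lra.
have c0 : 0 < Num.sqrt (1 + t) by rewrite sqrtr_gt0.
pose F y := gauss S M1 rho (scale_at S (Num.sqrt (1 + t)) y).
have FE y : F y = expR (- ((1 + t) * quadf M1 (restr S y) / 2) - rho / 2 * norm2 (y - restr S y) ^+ 2).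
  by rewrite /F /gauss restrC_scale_at restr_scale_at quadfZ sqr_sqrtr// ltW.
have mx i : measurable_rV (fun x : 'rV[R]_p => x 0 i) by exact: measurable_rV_coord.
have mF : measurable_rV F.
  apply: (eq_measurable_rV (fun y => esym (FE y))).
  apply: measurable_rV_expR; apply: measurable_rVB.
    apply: measurable_rVN; apply: measurable_rVM; last exact: measurable_rV_cst.
    apply: measurable_rVM; first exact: measurable_rV_cst.
    by apply: measurable_rV_quadf => i; exact: measurable_rV_restr.
  apply: measurable_rVM; first exact: measurable_rV_cst.
  apply: measurable_rV_sqr_norm2 => i; apply: measurable_rV_subv => // j.
  exact: measurable_rV_restr.
have F0 y : 0 <= F y by exact: gauss_ge0.
have IF0 := integral_rV_scale_at S c0 (measurable_rV_gauss S M1 rho) (gauss_ge0 S M1 rho).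
rewrite -/F in IF0; clearbody F.
have IF : (integral_rV F <= integral_rV (gauss S M2 rho))%E.
  apply: (le_integral_rV F0 _ mF (measurable_rV_gauss _ _ _)).
  move=> y; rewrite FE /gauss ler_expR lerD2r lerN2.
  by rewrite ler_pM2r ?invr_gt0.
have : integral_rV (gauss S M1 rho) = ((Num.sqrt (1 + t) ^+ #|S|)%:E * integral_rV F)%E.
  rewrite IF0 muleA -EFinM -exprMn divff; last by rewrite gt_eqF.
  by rewrite expr1n mul1e.
move=> ->; apply: (lee_pmul _ _ _ IF).
- by rewrite lee_fin exprn_ge0// ltW.
- exact: integral_rV_ge0.
- rewrite lee_fin -mulrA expRM_natl lerXn2r ?nnegrE ?expR_ge0 ?sqrtr_ge0//.
  rewrite -(@ler_pXn2r _ 2)// ?nnegrE ?expR_ge0 ?sqrtr_ge0//.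
  rewrite sqr_sqrtr ?(ltW t1)// -expRM_natl mulrCA divff// mulr1.
  exact: expR_ge1Dx.
Qed.

Lemma integral_rV_shear S U (A : 'M[R]_p) (f : 'rV[R]_p -> R) : (forall i, i \in S -> i \notin U) ->
  (forall x, restr S (x *m A) = x *m A) ->
  measurable_rV f -> (forall x, 0 <= f x) ->
  integral_rV (fun x => f (x + restr U x *m A)) = integral_rV f.
Proof.
move=> SU hA mf f0.
have := @integral_rV_affine _ _ S (fun=> 1) (fun x => restr U x *m A) f.
rewrite big1 ?mul1e; last by move=> *; rewrite invr1.
move=> <-//.
- congr integral_rV; apply/funext => x /=; congr f; apply/rowP => k.
  rewrite [LHS]mxE [RHS]mxE mul1r; case: ifPn => // kS.
  by rewrite -hA restrEx (negbTE kS) addr0.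
- move=> k; apply: measurable_rV_mulmx => i; apply: measurable_rV_restr => j.
  exact: measurable_rV_coord.
- move=> k x y _ xy; congr ((_ *m _) 0 k); apply/rowP => l; rewrite !restrEx.
  case: ifPn => // lU; apply: xy; apply: contraL lU => lS.
  exact: SU.
Qed.

(** Integrating out the coordinates in [T :\: S]: they are decoupled from those
    in [S] by the shear that completes the square, and then contribute one
    factor [sqrt (rho / k)] each. *)
Lemma gauss_integrate_out S T M (k rho : R) h : 0 < k -> 0 < rho -> S \subset T ->
  coercive T M k -> restr T h = h ->
  (integral_rV (fun x => expR (- (quadf M (restr T x - h) / 2)
      - rho / 2 * norm2 (x - restr T x) ^+ 2)) <=
   (Num.sqrt (rho / k) ^+ #|T :\: S|)%:E * integral_rV (gauss S M rho))%E.
Proof.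
move=> k0 rho0 ST hM hT.
have [A [hA sq]] := complete_square k0 ST hM.
pose U := (T :\: S)%SET.
pose c := Num.sqrt (k / rho).
have c0 : 0 < c by rewrite sqrtr_gt0 divr_gt0.
have mx i : measurable_rV (fun x : 'rV[R]_p => x 0 i) by exact: measurable_rV_coord.
have -> : (fun x => expR (- (quadf M (restr T x - h) / 2)
      - rho / 2 * norm2 (x - restr T x) ^+ 2)) = fun x => gauss T M rho (x - h).
  apply/funext => x; rewrite /gauss restrB hT; congr (expR (_ - _ * norm2 _ ^+ 2)).
  by rewrite opprB addrA subrK.
rewrite [X in (X <= _)%E](integral_rV_shift (- h) (measurable_rV_gauss T M rho) (gauss_ge0 T M rho)).
pose G y := gauss S M rho (scale_at U c y).
pose F x := G (x + restr U x *m A).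
have SU x : restr S (restr U x) = 0.
  apply/rowP => i; rewrite restrI restrEx !inE mxE.
  by case: (i \in S).
have GE y : G y = expR (- (quadf M (restr S y) / 2)
    - rho / 2 * norm2 (c *: restr U y + (y - restr U y - restr S y)) ^+ 2).
  rewrite /G /gauss; have -> : restr S (scale_at U c y) = restr S y.
    by rewrite restrD restrZ restrB SU scaler0 subr0 add0r.
  by rewrite /scale_at !addrA.
have G0 y : 0 <= G y by exact: gauss_ge0.
have mG : measurable_rV G.
  apply: (eq_measurable_rV (fun y => esym (GE y))).
  apply: measurable_rV_expR; apply: measurable_rVB.
    apply: measurable_rVN; apply: measurable_rVM; last exact: measurable_rV_cst.
    by apply: measurable_rV_quadf => i; exact: measurable_rV_restr.
  apply: measurable_rVM; first exact: measurable_rV_cst.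
  apply: measurable_rV_sqr_norm2 => i; apply: measurable_rV_addv => j.
    apply: (eq_measurable_rV (f := fun x => c * restr U x 0 j)).
      by move=> x; rewrite [RHS]mxE.
    by apply: measurable_rVM; [exact: measurable_rV_cst|exact: measurable_rV_restr].
  apply: measurable_rV_subv => l; last exact: measurable_rV_restr.
  by apply: measurable_rV_subv => // m; exact: measurable_rV_restr.
have FE x : F x = expR (- ((quadf M (restr S x + restr U x *m A) +
    k * norm2 (restr U x) ^+ 2) / 2) - rho / 2 * norm2 (x - restr T x) ^+ 2).
  rewrite /F GE restrD hA; congr expR.
  have UA : restr U (restr U x *m A) = 0.
    rewrite -hA; apply/rowP => i; rewrite restrI restrEx !inE [RHS]mxE.
    by case: (i \in S); rewrite /= ?andbF.
  rewrite restrD UA addr0.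
  have -> : norm2 (c *: restr U x + (x + restr U x *m A - restr U x -
      (restr S x + restr U x *m A))) ^+ 2 =
      c ^+ 2 * norm2 (restr U x) ^+ 2 + norm2 (x - restr T x) ^+ 2.
    rewrite !sqr_norm2 mulr_sumr -big_split/=; apply: eq_bigr => i _.
    move: (restr U x *m A) => b; rewrite !mxE.
    have := fintype.subsetP ST i; rewrite /U inE.
    case: (i \in S) => /= [->//|_].
      by rewrite /= !mulr0n !mulr1n; lra.
    by case: (i \in T) => /=; rewrite !mulr0n ?mulr1n; lra.
  rewrite /c sqr_sqrtr ?divr_ge0 ?ltW//.
  have -> : rho / 2 * (k / rho * norm2 (restr U x) ^+ 2 + norm2 (x - restr T x) ^+ 2) =
      (rho / rho) * k / 2 * norm2 (restr U x) ^+ 2 + rho / 2 * norm2 (x - restr T x) ^+ 2 by lra.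
  by rewrite divff ?gt_eqF//; lra.
have mF : measurable_rV F.
  apply: (eq_measurable_rV (fun y => esym (FE y))).
  apply: measurable_rV_expR; apply: measurable_rVB; last first.
    apply: measurable_rVM; first exact: measurable_rV_cst.
    apply: measurable_rV_sqr_norm2 => i; apply: measurable_rV_subv => // j.
    exact: measurable_rV_restr.
  apply: measurable_rVN; apply: measurable_rVM; last exact: measurable_rV_cst.
  apply: measurable_rVD.
    apply: measurable_rV_quadf => i; apply: measurable_rV_addv => j.
      exact: measurable_rV_restr.
    by apply: measurable_rV_mulmx => l; exact: measurable_rV_restr.
  apply: measurable_rVM; first exact: measurable_rV_cst.
  by apply: measurable_rV_sqr_norm2 => i; exact: measurable_rV_restr.
have leF x : gauss T M rho x <= F x.
  rewrite FE /gauss ler_expR lerD2r lerN2 ler_pM2r ?invr_gt0//.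
apply: (le_trans (le_integral_rV (gauss_ge0 T M rho) leF
  (measurable_rV_gauss T M rho) mF)).
have nSU i : i \in S -> i \notin U by rewrite !inE => ->.
have cV : c^-1 = Num.sqrt (rho / k).
  by rewrite /c -sqrtrV ?invf_div// divr_ge0 ?ltW.
have E1 : integral_rV F = integral_rV G := integral_rV_shear nSU hA mG G0.
have E2 : integral_rV G = ((c^-1 ^+ #|U|)%:E * integral_rV (gauss S M rho))%E :=
  integral_rV_scale_at U c0 (measurable_rV_gauss S M rho) (gauss_ge0 S M rho).
move: (etrans E1 E2); rewrite cV; clear; clearbody F => ->; exact: lexx.
Qed.

End gaussian_integrals.

(** * Directional derivatives and Taylor's inequality *)

Section taylor.
Context {R : realType}.
Implicit Types (f g : R -> R).

Lemma le0_is_derive f g : f 0 <= 0 ->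
  (forall t : R, is_derive t 1 f (g t)) -> (forall t, 0 <= t <= 1 -> g t <= 0) ->
  forall t, 0 <= t <= 1 -> f t <= 0.
Proof.
move=> f0 fg g0 t /andP[t0 t1].
have cf : {within `[0, t], continuous f}.
  by apply: derivable_within_continuous => x _; case: (fg x).
have [c + fc] := @MVT_segment _ f g 0 t t0 (fun x _ => fg x) cf.
rewrite in_itv/= => /andP[c0 ct].
have gc : g c <= 0 by apply: g0; rewrite c0 (le_trans ct).
have : g c * (t - 0) <= 0 by rewrite subr0 mulr_le0_ge0.
by rewrite -fc; lra.
Qed.

(** The bound on the third derivative is integrated three times, each time by the
    mean value inequality applied to the difference with the Taylor polynomial. *)
Lemma taylor2_le (f0 f1 f2 f3 : R -> R) (K : R) :
  (forall t : R, is_derive t 1 f0 (f1 t)) ->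
  (forall t : R, is_derive t 1 f1 (f2 t)) ->
  (forall t : R, is_derive t 1 f2 (f3 t)) ->
  (forall t, 0 <= t <= 1 -> f3 t <= K) ->
  f0 1 <= f0 0 + f1 0 + f2 0 / 2 + K / 6.
Proof.
move=> d0 d1 d2 h3.
have h2 t : 0 <= t <= 1 -> f2 t - (f2 0 + K * t) <= 0.
  apply: (@le0_is_derive (fun t => f2 t - (f2 0 + K * t)) (fun t => f3 t - K)) => [|s|s].
  - by rewrite mulr0 addr0 subrr.
  - by apply: is_derive_eq; rewrite /GRing.scale/=; lra.
  - by move=> /h3; lra.
have h1 t : 0 <= t <= 1 -> f1 t - (f1 0 + f2 0 * t + K / 2 * t ^+ 2) <= 0.
  apply: (@le0_is_derive (fun t => f1 t - (f1 0 + f2 0 * t + K / 2 * t ^+ 2))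
    (fun t => f2 t - (f2 0 + K * t))) => [|s|//].
  - by rewrite expr0n/= !mulr0 !addr0 subrr.
  - by apply: is_derive_eq; rewrite /GRing.scale/=; lra.
have h0 t : 0 <= t <= 1 ->
    f0 t - (f0 0 + f1 0 * t + f2 0 / 2 * t ^+ 2 + K / 6 * t ^+ 3) <= 0.
  apply: (@le0_is_derive (fun t => f0 t - (f0 0 + f1 0 * t + f2 0 / 2 * t ^+ 2 + K / 6 * t ^+ 3))
    (fun t => f1 t - (f1 0 + f2 0 * t + K / 2 * t ^+ 2))) => [|s|//].
  - by rewrite !expr0n/= !mulr0 !addr0 subrr.
  - by apply: is_derive_eq; rewrite /GRing.scale/=; lra.
by have := h0 1; rewrite ler01 lexx => /(_ isT); lra.
Qed.

End taylor.

Section directional_derivatives.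
Context {R : realType} {n : nat}.
Implicit Types (F G : 'rV[R]_n -> R) (x u v w : 'rV[R]_n).

(** The difference quotients of [F] along a line are those that define the
    directional derivative, so no chain rule is involved. *)
Lemma is_derive_line F x v (t : R) : (forall y, differentiable F y) ->
  is_derive t 1 (fun s : R => F (x + s *: v)) ('D_v F (x + t *: v)).
Proof.
move=> dF; have E : (fun h : R => h^-1 *: (((fun s : R => F (x + s *: v)) \o shift t) (h *: (1 : R^o))
    - F (x + t *: v))) =
  (fun h : R => h^-1 *: ((F \o shift (x + t *: v)) (h *: v) - F (x + t *: v))).
  apply/funext => h /=; congr (_ *: (F _ - _)).
  by rewrite scalerDl [h *: 1]mulr1 addrCA.
split; first by rewrite /derivable E; exact: diff_derivable.
by rewrite /derive E.
Qed.

Lemma derive_partial F x v : (forall y, differentiable F y) ->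
  'D_v F x = \sum_i v 0 i * partial i F x.
Proof.
move=> dF; rewrite deriveE// {1}(row_sum_delta v) linear_sum/=.
by apply: eq_bigr => i _; rewrite linearZ /partial deriveE.
Qed.

Lemma derive_sum_scale m (c : 'I_m -> R) (H : 'I_m -> 'rV[R]_n -> R) x u :
  (forall i y, differentiable (H i) y) ->
  'D_u (fun y => \sum_i c i * H i y) x = \sum_i c i * 'D_u (H i) x.
Proof.
move=> dH; have -> : (fun y => \sum_i c i * H i y) = \sum_i (c i \*: H i).
  by apply/funext => y; rewrite fct_sumE.
rewrite derive_sum; last by move=> i; apply: derivableZ; exact: diff_derivable.
by apply: eq_bigr => i _; rewrite deriveZ//; exact: diff_derivable.
Qed.

Lemma derive2_partial F x u v : times_differentiable 2 F ->
  'D_u ('D_v F) x = \sum_i \sum_j u 0 i * v 0 j * partial i (partial j F) x.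
Proof.
move=> [dF d2F]; have -> : 'D_v F = fun y => \sum_j v 0 j * partial j F y.
  by apply/funext => y; exact: derive_partial.
have dp j y : differentiable (partial j F) y by have [] := d2F (delta_mx 0 j).
rewrite derive_sum_scale// exchange_big/=; apply: eq_bigr => j _.
rewrite derive_partial// mulr_sumr; apply: eq_bigr => i _.
by rewrite mulrCA mulrA.
Qed.

Lemma derive3_partial F x u v w : times_differentiable 3 F ->
  'D_u ('D_v ('D_w F)) x =
  \sum_i \sum_j \sum_k u 0 i * v 0 j * w 0 k * partial i (partial j (partial k F)) x.
Proof.
move=> [dF d3F]; have -> : 'D_w F = fun y => \sum_k w 0 k * partial k F y.
  by apply/funext => y; exact: derive_partial.
have d2p k : times_differentiable 2 (partial k F) by exact: d3F.
have dp k y : differentiable (partial k F) y by have [] := d2p k.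
have -> : 'D_v (fun y => \sum_k w 0 k * partial k F y) =
    fun y => \sum_k w 0 k * 'D_v (partial k F) y.
  by apply/funext => y; exact: derive_sum_scale.
rewrite derive_sum_scale; last first.
  by move=> k y; have [_ h] := d2p k; have [] := h v.
have E k : w 0 k * 'D_u ('D_v (partial k F)) x =
    \sum_i \sum_j u 0 i * v 0 j * w 0 k * partial i (partial j (partial k F)) x.
  rewrite (derive2_partial x u v (d2p k)) mulr_sumr; apply: eq_bigr => i _.
  rewrite mulr_sumr; apply: eq_bigr => j _.
  by rewrite mulrA; congr (_ * _); rewrite mulrC.
transitivity (\sum_k \sum_i \sum_j
    u 0 i * v 0 j * w 0 k * partial i (partial j (partial k F)) x).
  apply: eq_bigr => k _.
  exact: E.
transitivity (\sum_i \sum_k \sum_j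
    u 0 i * v 0 j * w 0 k * partial i (partial j (partial k F)) x).
  exact: exchange_big.
apply: eq_bigr => i _.
exact: exchange_big.
Qed.

Lemma derive2_quadf_hess F x v : times_differentiable 2 F ->
  'D_v ('D_v F) x = - quadf (- hess F x) v.
Proof.
move=> dF; rewrite derive2_partial// quadfE -sumrN; apply: eq_bigr => i _.
rewrite -sumrN; apply: eq_bigr => j _.
by rewrite !mxE mulrN mulNr opprK mulrAC.
Qed.

Lemma norm_derive3_le F x u v w (K : R) : times_differentiable 3 F ->
  (forall i j k, `|partial i (partial j (partial k F)) x| <= K) ->
  `|'D_u ('D_v ('D_w F)) x| <= K * (norm1 u * norm1 v * norm1 w).
Proof.
move=> dF hK; rewrite derive3_partial//.
have -> : K * (norm1 u * norm1 v * norm1 w) =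
    \sum_i \sum_j \sum_k `|u 0 i| * `|v 0 j| * `|w 0 k| * K.
  rewrite /norm1 [RHS](eq_bigr (fun i => `|u 0 i| * (norm1 v * norm1 w * K))).
    by rewrite -mulr_suml mulrC !mulrA.
  move=> i _; rewrite [LHS](eq_bigr (fun j => `|u 0 i| * (norm1 w * K) * `|v 0 j|)).
    by rewrite -mulr_sumr -/(norm1 v); lra.
  move=> j _; rewrite -!mulr_suml -mulr_sumr -/(norm1 w); lra.
apply: (le_trans (ler_norm_sum _ _ _)); apply: ler_sum => i _.
apply: (le_trans (ler_norm_sum _ _ _)); apply: ler_sum => j _.
apply: (le_trans (ler_norm_sum _ _ _)); apply: ler_sum => k _.
by rewrite !normrM ler_wpM2l// !mulr_ge0.
Qed.

End directional_derivatives.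

(** * Functions of the selected components of a sparse vector *)

Section sparse_embedding.
Context {R : realType} {p : nat} (delta : {set 'I_p}).
Implicit Types (w v : 'rV[R]_#|delta|) (x : 'rV[R]_p) (f : 'rV[R]_p -> R).

Lemma embedE w i : embed w 0 i = \sum_k w 0 k * (i == enum_val k)%:R.
Proof.
by rewrite /embed summxE; apply: eq_bigr => k _; rewrite !mxE eqxx.
Qed.

Lemma embed_enum w (k : 'I_#|delta|) : embed w 0 (enum_val k) = w 0 k.
Proof.
rewrite embedE (bigD1 k)//= eqxx mulr1 big1 ?addr0// => l lk.
by rewrite (inj_eq enum_val_inj) eq_sym (negbTE lk) mulr0.
Qed.

Lemma restr_embed w : restr delta (embed w) = embed w.
Proof.
apply/rowP => i; rewrite restrEx; case: ifPn => // id.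
rewrite embedE big1// => k _; case: eqP => [ik|_]; last by rewrite mulr0.
by move: id; rewrite ik enum_valP.
Qed.

Lemma embed_linear : linear (@embed R p delta).
Proof.
move=> a u v; rewrite /embed scaler_sumr -big_split/=; apply: eq_bigr => k _.
by rewrite scalerA -scalerDl !mxE.
Qed.

HB.instance Definition _ :=
  GRing.isLinear.Build R _ _ _ (@embed R p delta) embed_linear.

Definition select x : 'rV[R]_#|delta| := \row_k x 0 (enum_val k).

Lemma selectK x : restr delta x = x -> embed (select x) = x.
Proof.
move=> dx; apply/rowP => i; case: (boolP (i \in delta)) => id.
  rewrite -(enum_rankK_in id id) embed_enum mxE//.
by rewrite -restr_embed -[in RHS]dx !restrEx (negbTE id).
Qed.

Lemma norm1_embed w : norm1 (embed w) = norm1 w.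
Proof.
rewrite /norm1 [LHS](bigID (mem delta))/= addrC big1 ?add0r; last first.
  by move=> i id; rewrite -restr_embed restrEx (negbTE id) normr0.
rewrite big_enum_val/=; apply: eq_bigr => k _; by rewrite embed_enum.
Qed.

Lemma norm2_embed w : norm2 (embed w) = norm2 w.
Proof.
rewrite /norm2 /dotv; congr Num.sqrt.
rewrite [LHS](bigID (mem delta))/= addrC big1 ?add0r; last first.
  by move=> i id; rewrite -restr_embed restrEx (negbTE id) mul0r.
rewrite big_enum_val/=; apply: eq_bigr => k _; by rewrite embed_enum.
Qed.

Lemma derive_embed f w v : 'D_v (fun y => f (embed y)) w = 'D_(embed v) f (embed w).
Proof.
have E : (fun h : R => h^-1 *: (((fun y => f (embed y)) \o shift w) (h *: v) -
      f (embed w))) =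
    (fun h => h^-1 *: ((f \o shift (embed w)) (h *: embed v) - f (embed w))).
  apply/funext => h /=; congr (_ *: (f _ - _)); exact: embed_linear.
by rewrite /derive E.
Qed.

Lemma differentiable_embed w : differentiable (@embed R p delta) w.
Proof.
apply: (@linear_differentiable _ _ _ (@embed R p delta)).
move=> y; apply: differentiable_continuous.
pose h (k : 'I_#|delta|) (w : 'rV[R]_#|delta|) : 'rV[R]_p :=
  w 0 k *: delta_mx 0 (enum_val k).
have dsum (r : seq 'I_#|delta|) : differentiable (fun w => \sum_(k <- r) h k w) y.
  elim: r => [|k r IH].
    have -> : (fun w => \sum_(k <- [::]) h k w) = fun=> 0.
      by apply/funext => v; rewrite big_nil.
    exact: differentiable_cst.
  have -> : (fun w => \sum_(l <- k :: r) h l w) =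
      (h k : 'rV[R]_#|delta| -> 'rV[R]_p) + (fun w => \sum_(l <- r) h l w).
    by apply/funext => v; rewrite big_cons.
  apply: differentiableD => //; apply: differentiableZl; exact: differentiable_coord.
exact: (dsum (index_enum 'I_#|delta|)).
Qed.

Lemma times_differentiable_embed k f :
  times_differentiable k f -> times_differentiable k (fun w => f (embed w)).
Proof.
elim: k f => // k IH f [df Df]; split => [w|v].
  by apply: differentiable_comp; [exact: differentiable_embed|exact: df].
have -> : 'D_v (fun w => f (embed w)) = fun w => ('D_(embed v) f) (embed w).
  by apply/funext => w; exact: derive_embed.
by apply: (IH ('D_(embed v) f)); exact: Df.
Qed.

End sparse_embedding.

(** * Quadratic expansion around a sparse maximizer *)

Section local_expansion.
Context {R : realType} {p : nat}.
Variables (f : 'rV[R]_p -> R) (df : times_differentiable 3 f).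
Implicit Types (x y u v w h : 'rV[R]_p) (S T : {set 'I_p}).

(** The bound is stated for arbitrary sparse directions, through their l1 norms,
    so that it can be used without choosing coordinates on [R^S]. *)
Definition third_order_bound S h (rad a : R) : Prop :=
  forall x u v w, restr S x = x -> norm2 (x - h) <= rad ->
    restr S u = u -> restr S v = v -> restr S w = w ->
    `|'D_u ('D_v ('D_w f)) x| <= a * (norm1 u * norm1 v * norm1 w).

Definition maximizes_on S h : Prop :=
  restr S h = h /\ forall x, restr S x = x -> f x <= f h.

Let df0 x : differentiable f x. Proof. by case: df. Qed.
Let df1 v x : differentiable ('D_v f) x. Proof. by case: df => _ /(_ v)[]. Qed.
Let df2 u v x : differentiable ('D_u ('D_v f)) x.
Proof. by case: df => _ /(_ v)[_ /(_ u)[]]. Qed.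

Lemma derive_maximizer S h v : maximizes_on S h -> restr S v = v -> 'D_v f h = 0.
Proof.
move=> [hS hmax] vS.
have dl (t : R) : is_derive t 1 (fun s : R => f (h + s *: v)) ('D_v f (h + t *: v)).
  exact: is_derive_line.
have d0 : is_derive (0 : R) 1 (fun s : R => f (h + s *: v)) 0.
  apply: (@derive1_at_max _ _ (-1) 1).
  - lra.
  - by move=> t _; case: (dl t).
  - by rewrite in_itv/=; apply/andP; split; lra.
  - move=> t _; rewrite scale0r addr0; apply: hmax.
    by rewrite restrD restrZ hS vS.
have := dl 0; rewrite scale0r addr0 => -[_ <-].
by case: d0.
Qed.

(** The first-order term vanishes at a maximizer, and the cubic remainder is
    bounded through the l1 norm, which on sparse vectors costs a factor
    [sqrt #|S|]. *)
Lemma quadratic_expansion S h (rad a : R) x : 0 <= a ->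
  maximizes_on S h -> third_order_bound S h rad a ->
  restr S x = x -> norm2 (x - h) <= rad ->
  `|f x - f h + quadf (- hess f h) (x - h) / 2| <=
  a / 6 * (Num.sqrt #|S|%:R * rad) ^+ 3.
Proof.
move=> a0 hmax hK xS xr; have [hS _] := hmax.
pose v := x - h.
have vS : restr S v = v by rewrite restrB xS hS.
pose K := a * (norm1 v * norm1 v * norm1 v).
have lineE : h + (1 : R) *: v = x by rewrite scale1r addrC subrK.
have b3 t : 0 <= t <= 1 -> `|'D_v ('D_v ('D_v f)) (h + t *: v)| <= K.
  move=> /andP[t0 t1]; apply: hK => //; first by rewrite restrD restrZ hS vS.
  rewrite addrC addKr norm2Z ger0_norm//; apply: le_trans xr.
  by rewrite -[leRHS]mul1r ler_wpM2r// norm2_ge0.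
have d0 (t : R) : is_derive t 1 (fun s : R => f (h + s *: v)) ('D_v f (h + t *: v)).
  exact: is_derive_line.
have d1 (t : R) : is_derive t 1 (fun s : R => 'D_v f (h + s *: v))
    ('D_v ('D_v f) (h + t *: v)).
  by apply: is_derive_line => y; exact: df1.
have d2 (t : R) : is_derive t 1 (fun s : R => 'D_v ('D_v f) (h + s *: v))
    ('D_v ('D_v ('D_v f)) (h + t *: v)).
  by apply: is_derive_line => y; exact: df2.
have q2 : 'D_v ('D_v f) h = - quadf (- hess f h) v.
  by apply: derive2_quadf_hess; case: df => ? h3; split => // w; case: (h3 w) => ? h4; split => // u; case: (h4 u).
have q1 := derive_maximizer hmax vS.
have up : f x <= f h + 0 - quadf (- hess f h) v / 2 + K / 6.
  have := taylor2_le d0 d1 d2 (fun t ht => le_trans (ler_norm _) (b3 t ht)).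
  by rewrite lineE scale0r addr0 q1 q2; lra.
have dn : - f x <= - f h + 0 + quadf (- hess f h) v / 2 + K / 6.
  have d0' (t : R) : is_derive t 1 (fun s : R => - f (h + s *: v)) (- 'D_v f (h + t *: v)).
    exact: is_deriveN.
  have d1' (t : R) : is_derive t 1 (fun s : R => - 'D_v f (h + s *: v))
    (- 'D_v ('D_v f) (h + t *: v)) by exact: is_deriveN.
  have d2' (t : R) : is_derive t 1 (fun s : R => - 'D_v ('D_v f) (h + s *: v))
    (- 'D_v ('D_v ('D_v f)) (h + t *: v)) by exact: is_deriveN.
  have b3' t : 0 <= t <= 1 -> - 'D_v ('D_v ('D_v f)) (h + t *: v) <= K.
    by move=> /b3; rewrite ler_norml => /andP[+ _]; rewrite lerNl.
  have := taylor2_le d0' d1' d2' b3'.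
  by rewrite lineE scale0r addr0 q1 q2; lra.
have n1 : norm1 v <= Num.sqrt #|S|%:R * rad.
  rewrite -vS; apply: (le_trans (norm1_restr _ _)).
  by rewrite vS ler_wpM2l// sqrtr_ge0.
have KK : K <= a * (Num.sqrt #|S|%:R * rad) ^+ 3.
  rewrite /K ler_wpM2l// -expr2 -exprSr lerXn2r// nnegrE ?norm1_ge0//.
  exact: le_trans (norm1_ge0 _) n1.
by rewrite ler_norml -/v; apply/andP; split; lra.
Qed.

(** The two Hessians are compared along the segment that joins [h] to [h'], on
    which the third derivatives are controlled. *)
Lemma hess_compare S T h h' v (rad a k : R) : 0 <= a -> 0 < k -> S \subset T ->
  third_order_bound T h rad a -> restr T h = h -> restr T h' = h' ->
  norm2 (h' - h) <= rad -> restr S v = v ->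
  k * norm2 v ^+ 2 <= quadf (- hess f h) v ->
  quadf (- hess f h') v <=
  (1 + a * (Num.sqrt #|T|%:R * norm2 (h' - h)) * #|S|%:R / k) * quadf (- hess f h) v.
Proof.
move=> a0 k0 ST hK hT h'T hh' vS hk.
have vT : restr T v = v by rewrite -vS restr_sub'.
pose w := h' - h.
have wT : restr T w = w by rewrite restrB hT h'T.
have d2f : times_differentiable 2 f.
  by case: df => ? h3; split => // y; case: (h3 y) => ? h4; split => // u; case: (h4 u).
have d2 (t : R) : is_derive t 1 (fun s : R => 'D_v ('D_v f) (h + s *: w))
    ('D_w ('D_v ('D_v f)) (h + t *: w)).
  by apply: is_derive_line => y; exact: df2.
have cf : {within `[(0 : R), 1], continuous (fun s : R => 'D_v ('D_v f) (h + s *: w))}.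
  by apply: derivable_within_continuous => t _; case: (d2 t).
have [c + E] := MVT_segment ler01 (fun t _ => d2 t) cf.
rewrite in_itv/= => /andP[c0 c1].
have := hK (h + c *: w) w v v; rewrite wT vT.
have -> : restr T (h + c *: w) = h + c *: w by rewrite restrD restrZ hT wT.
have cw : norm2 (h + c *: w - h) <= rad.
  rewrite addrC addKr norm2Z ger0_norm//; apply: le_trans hh'.
  by rewrite -[leRHS]mul1r ler_wpM2r// norm2_ge0.
move=> /(_ erefl cw erefl erefl erefl).
move: E; rewrite scale1r scale0r addr0 subr0 mulr1 [h + w]addrC subrK => <-.
rewrite !(derive2_quadf_hess _ _ d2f) ler_norml => /andP[lo _].
have w1 : norm1 w <= Num.sqrt #|T|%:R * norm2 w.
  by rewrite -{1}wT; apply: (le_trans (norm1_restr _ _)); rewrite wT.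
have v1 : norm1 v * norm1 v <= #|S|%:R * norm2 v ^+ 2.
  have : norm1 v <= Num.sqrt #|S|%:R * norm2 v.
    by rewrite -{1}vS; apply: (le_trans (norm1_restr _ _)); rewrite vS.
  move=> h1; rewrite -expr2.
  rewrite -[X in X * norm2 v ^+ 2]sqr_sqrtr// -exprMn lerXn2r ?nnegrE ?norm1_ge0//.
  by rewrite mulr_ge0 ?sqrtr_ge0 ?norm2_ge0.
have q : norm2 v ^+ 2 <= quadf (- hess f h) v / k.
  by rewrite ler_pdivlMr// mulrC.
have step : a * (norm1 w * norm1 v * norm1 v) <=
    a * (Num.sqrt #|T|%:R * norm2 w) * #|S|%:R / k * quadf (- hess f h) v.
  rewrite -!mulrA ler_wpM2l// !mulrA.
  have -> : Num.sqrt #|T|%:R * norm2 w * #|S|%:R / k * quadf (- hess f h) v =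
    (Num.sqrt #|T|%:R * norm2 w) * (#|S|%:R * (quadf (- hess f h) v / k)).
    by rewrite -!mulrA; congr (_ * (_ * (_ * _))); rewrite mulrC.
  rewrite -mulrA; apply: ler_pM => //; rewrite ?norm1_ge0// ?mulr_ge0 ?norm1_ge0//.
  by apply: (le_trans v1); rewrite ler_wpM2l.
move: lo; rewrite opprK lerNl opprD opprK => lo.
by rewrite mulrDl mul1r -lerBlDl (le_trans lo step).
Qed.

End local_expansion.

(** * The quasi-posterior density *)

Section density.
Context {R : realType} {p : nat} {Z : Type}.
Variables (rho0 rho1 : R) (omega : {set 'I_p} -> R) (ell : 'rV[R]_p -> Z -> R).
Implicit Types (x y theta : 'rV[R]_p) (S T delta : {set 'I_p}) (z : Z).
Local Notation rT := (measurableTypeR R).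

Lemma measurable_rV_comp_restr S (f : 'rV[R]_p -> R) :
  measurable_rV f -> measurable_rV (fun x => f (restr S x)).
Proof.
move=> mf; pose g (t : p.-tuple rT) : p.-tuple rT :=
  [tuple if k \in S then tnth t k else 0 | k < p].
have mg : measurable_fun setT g.
  apply/measurable_fun_tnthP => k.
  apply: (eq_measurable_fun (fun t : p.-tuple rT => if k \in S then tnth t k else 0)).
    by move=> t _; rewrite /= tnth_mktuple.
  by case: (k \in S); [exact: measurable_tnth|exact: measurable_cst].
rewrite /measurable_rV (_ : (fun t => _) = (fun t => f (tuple_rV t)) \o g).
  exact: measurableT_comp.
apply/funext => t /=; congr f; apply/rowP => k.
by rewrite restrEx !mxE tnth_mktuple.
Qed.

Definition qp_weight delta : R := omega delta *
  (rho1 / (2 * pi)) `^ (#|delta|%:R / 2) *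
  (rho0 / (2 * pi)) `^ ((p - #|delta|)%:R / 2).

Lemma qp_densityE z delta theta : qp_density rho0 rho1 omega ell z delta theta =
  qp_weight delta * expR (ell (restr delta theta) z
    - rho1 / 2 * norm2 (restr delta theta) ^+ 2
    - rho0 / 2 * norm2 (theta - restr delta theta) ^+ 2).
Proof.
rewrite /qp_density /qp_weight 2!expRD -!mulrA mulrC -!mulrA.
by congr (_ * (_ * (_ * _))); rewrite mulrA mulrC.
Qed.

Hypothesis omega_ge0 : forall delta, 0 <= omega delta.

Lemma qp_weight_ge0 delta : 0 <= qp_weight delta.
Proof. by rewrite /qp_weight !mulr_ge0 ?powR_ge0. Qed.

Lemma qp_density_ge0 z delta theta : 0 <= qp_density rho0 rho1 omega ell z delta theta.
Proof. by rewrite qp_densityE mulr_ge0 ?qp_weight_ge0 ?expR_ge0. Qed.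

Lemma measurable_rV_qp_density z delta : measurable_rV (ell ^~ z) ->
  measurable_rV (qp_density rho0 rho1 omega ell z delta).
Proof.
move=> mf; apply: (eq_measurable_rV (fun x => esym (qp_densityE z delta x))).
have mx i : measurable_rV (fun x : 'rV[R]_p => x 0 i) by exact: measurable_rV_coord.
apply: measurable_rVM; first exact: measurable_rV_cst.
apply: measurable_rV_expR; apply: measurable_rVB; last first.
  apply: measurable_rVM; first exact: measurable_rV_cst.
  apply: measurable_rV_sqr_norm2 => i; apply: measurable_rV_subv => // j.
  exact: measurable_rV_restr.
apply: measurable_rVB; first exact: measurable_rV_comp_restr mf.
apply: measurable_rVM; first exact: measurable_rV_cst.
by apply: measurable_rV_sqr_norm2 => i; exact: measurable_rV_restr.
Qed.

End density.

Section prior_variation.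
Context {R : realType} {p : nat}.
Variable thetas : 'rV[R]_p.
Let s := #|supp thetas|.

(** Only the support of [thetas] contributes, hence the factor [sqrt s] instead of
    a power of the dimension. This makes the Gaussian prior almost constant near
    [thetas]. *)
Lemma dotv_supp_le w : `|dotv thetas w| <= `|thetas| * Num.sqrt s%:R * norm2 w.
Proof.
have -> : dotv thetas w = \sum_i thetas 0 i * restr (supp thetas) w 0 i.
  apply: eq_bigr => i _; rewrite restrEx inE; case: eqP => [->|//].
  by rewrite !mul0r.
apply: (le_trans (ler_norm_sum _ _ _)).
apply: (@le_trans _ _ (`|thetas| * norm1 (restr (supp thetas) w))).
  rewrite mulr_sumr; apply: ler_sum => i _; rewrite normrM ler_wpM2r//.
  exact: ler_coord_norm.
rewrite -mulrA ler_wpM2l//; apply: (le_trans (norm1_restr _ _)).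
by rewrite ler_wpM2l ?sqrtr_ge0// norm2_restr_le.
Qed.

Lemma sqr_norm2_near y (r : R) : norm2 (y - thetas) <= r ->
  - (2 * (`|thetas| * Num.sqrt s%:R * r)) <= norm2 y ^+ 2 - norm2 thetas ^+ 2 <=
  2 * (`|thetas| * Num.sqrt s%:R * r) + r ^+ 2.
Proof.
move=> yr.
have -> : norm2 y ^+ 2 - norm2 thetas ^+ 2 =
    2 * dotv thetas (y - thetas) + norm2 (y - thetas) ^+ 2.
  rewrite !sqr_norm2 /dotv mulr_sumr -sumrB -big_split/=; apply: eq_bigr => i _.
  by rewrite !mxE; lra.
have h1 : `|thetas| * Num.sqrt s%:R * norm2 (y - thetas) <= `|thetas| * Num.sqrt s%:R * r.
  by rewrite ler_wpM2l// mulr_ge0// sqrtr_ge0.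
have := dotv_supp_le (y - thetas); rewrite ler_norml => /andP[h2 h3].
have h4 : norm2 (y - thetas) ^+ 2 <= r ^+ 2.
  by rewrite lerXn2r// nnegrE ?norm2_ge0// (le_trans (norm2_ge0 _) yr).
have h5 : 0 <= norm2 (y - thetas) ^+ 2 by exact: sqr_ge0.
by apply/andP; split; lra.
Qed.

End prior_variation.

Section set_integrals.
Context {R : realType} {p : nat}.
Local Notation rT := (measurableTypeR R).
Implicit Types (f g : 'rV[R]_p -> R).

Lemma le_integral_set_rV (A : set (p.-tuple rT)) f g : measurable A ->
  (forall x, 0 <= f x) -> (forall x, 0 <= g x) ->
  measurable_rV f -> measurable_rV g ->
  (forall t, A t -> f (tuple_rV t) <= g (tuple_rV t)) ->
  (\int[lebesgue_tuple p]_(t in A) (f (tuple_rV t))%:E <= integral_rV g)%E.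
Proof.
move=> mA f0 g0 mf mg fg.
have mf' : measurable_fun A (fun t : p.-tuple rT => (f (tuple_rV t))%:E).
  by apply: measurable_funTS; apply/measurable_EFinP; exact: mf.
have mg' : measurable_fun [set: p.-tuple rT] (fun t : p.-tuple rT => (g (tuple_rV t))%:E).
  by apply/measurable_EFinP; exact: mg.
apply: (@le_trans _ _ (\int[lebesgue_tuple p]_(t in A) (g (tuple_rV t))%:E)%E).
  apply: ge0_le_integral => //.
  - by move=> t _; rewrite lee_fin; exact: f0.
  - by apply: measurable_funTS; exact: mg'.
apply: ge0_subset_integral => //.
by move=> t _; rewrite lee_fin; exact: g0.
Qed.

End set_integrals.

(** * Mass of a supermodel against mass of the true model *)

Section exponents.
Context {R : realType}.

Lemma upper_exponent (fy fh Q T rho N Ns X V : R) : 0 <= rho ->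
  `|fy - fh + Q / 2| <= T -> - (2 * X) <= N - Ns ->
  fy - rho / 2 * N - V <= (fh - rho / 2 * Ns + (rho * X + T)) + (- (Q / 2) - V).
Proof.
move=> r0; rewrite ler_norml => /andP[_ h1] h2.
by have := ler_wpM2l r0 h2; lra.
Qed.

Lemma lower_exponent (fy fh Q T rho N Ns X r2 V : R) : 0 <= rho ->
  `|fy - fh + Q / 2| <= T -> N - Ns <= 2 * X + r2 ->
  (fh - rho / 2 * Ns - (rho * X + rho / 2 * r2 + T)) + (- (Q / 2) - V) <=
  fy - rho / 2 * N - V.
Proof.
move=> r0; rewrite ler_norml => /andP[h1 _] h2.
by have := ler_wpM2l r0 h2; lra.
Qed.

Lemma mule_chain (X I0 I1 J : \bar R) (c1 c2 c3 c4 : R) :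
  0 <= c1 -> 0 <= c2 -> 0 <= c3 -> 0 < c4 ->
  (X <= c1%:E * (c2%:E * I1))%E -> (I1 <= c3%:E * I0)%E ->
  (c4%:E * I0 <= 2%:E * J)%E ->
  (X <= (2 * (c1 / c4) * c2 * c3)%:E * J)%E.
Proof.
move=> h1 h2 h3 h4 hX hI hJ; apply: (le_trans hX).
apply: (@le_trans _ _ ((c1 * c2 * c3)%:E * I0)%E).
  rewrite muleA -EFinM [in leRHS]EFinM -[leRHS]muleA lee_wpmul2l//.
  by rewrite lee_fin mulr_ge0.
have -> : c1 * c2 * c3 = (c1 / c4 * c2 * c3) * c4.
  by rewrite -[LHS]mul1r -(mulVf (lt0r_neq0 h4)); lra.
rewrite EFinM -muleA.
have -> : 2 * (c1 / c4) * c2 * c3 = (c1 / c4 * c2 * c3) * 2 by lra.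
rewrite [in leRHS]EFinM -[leRHS]muleA lee_wpmul2l// lee_fin.
by rewrite !mulr_ge0 ?invr_ge0// ltW.
Qed.

Lemma ratio_exponent (w1 w2 q fd fs N e1 e2 d : R) :
  2 * (w1 * expR (fd - N + e1) / (w2 * expR (fs - N - e2))) * q * expR d =
  2 * (w1 / w2 * expR (fd - fs)) * q * expR (e1 + e2 + d).
Proof.
have E : expR (fd - N + e1) * (expR (fs - N - e2))^-1 * expR d =
    expR (fd - fs) * expR (e1 + e2 + d).
  by rewrite -expRN -!expRD; congr expR; lra.
rewrite invfM; transitivity (2 * (w1 / w2) * q *
  (expR (fd - N + e1) * (expR (fs - N - e2))^-1 * expR d)); first by lra.
by rewrite E; lra.
Qed.

End exponents.

Section mass_ratio.
Context {R : realType} {p : nat} {Z : Type}.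
Variables (rho0 rho1 : R) (omega : {set 'I_p} -> R) (ell : 'rV[R]_p -> Z -> R) (z : Z).
Variables (thetas : 'rV[R]_p) (C eps kappa a : R).
Local Notation rT := (measurableTypeR R).
Local Notation f := (ell ^~ z).
Local Notation S := (supp thetas).
Local Notation dens := (qp_density rho0 rho1 omega ell z).
Local Notation weight := (qp_weight rho0 rho1 omega).
Implicit Types (delta : {set 'I_p}) (h x : 'rV[R]_p).
Hypotheses (rho0_gt0 : 0 < rho0) (rho1_gt0 : 0 < rho1)
  (omega_gt0 : forall delta, 0 < omega delta)
  (df : times_differentiable 3 f) (mf : measurable_rV f)
  (C_ge3 : 3 <= C) (eps_gt0 : 0 < eps) (kappa_gt0 : 0 < kappa) (a_ge0 : 0 <= a).

(** All that the comparison of masses uses about the log-likelihood on the model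
    [delta]. *)
Definition local_maximum_data delta h : Prop :=
  [/\ maximizes_on f delta h, norm2 (h - thetas) <= eps,
      third_order_bound f delta h ((C + 1) * eps) a &
      coercive delta (- hess f h) kappa].

Definition prior_error : R := rho1 * (`|thetas| * Num.sqrt #|S|%:R * (C * eps)).

Definition cubic_error delta : R :=
  a / 6 * (Num.sqrt #|delta|%:R * ((C + 1) * eps)) ^+ 3.

Let omega_ge0 delta : 0 <= omega delta. Proof. exact: ltW. Qed.

Lemma qp_weight_gt0 delta : 0 < weight delta.
Proof.
have pi2 : 0 < 2 * pi :> R by rewrite mulr_gt0// pi_gt0.
by apply: mulr_gt0; [apply: mulr_gt0 => //|]; apply/powR_gt0/divr_gt0.
Qed.

(** On the ball around [thetas] the log-density is at most its quadratic
    expansion at [h], up to the error terms; the coordinates of [delta] outside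
    the support of [thetas] are then integrated out. *)
Lemma integral_qp_density_le delta h (A : set (p.-tuple rT)) :
  S \subset delta -> local_maximum_data delta h -> measurable A ->
  (forall t, A t -> norm2 (restr delta (tuple_rV t) - thetas) <= C * eps) ->
  (\int[lebesgue_tuple p]_(t in A) (dens delta (tuple_rV t))%:E <=
   (weight delta * expR (f h - rho1 / 2 * norm2 thetas ^+ 2 +
      (prior_error + cubic_error delta)))%:E *
   ((Num.sqrt (rho0 / kappa) ^+ #|delta :\: S|)%:E *
    integral_rV (gauss S (- hess f h) rho0)))%E.
Proof.
move=> Sd [hmax hth h3 hco] mA hA; have [hd _] := hmax.
set c := weight delta * expR _.
have c0 : 0 <= c by rewrite mulr_ge0 ?expR_ge0// ltW// qp_weight_gt0.
pose M := - hess f h.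
pose g x := expR (- (quadf M (restr delta x - h) / 2)
  - rho0 / 2 * norm2 (x - restr delta x) ^+ 2).
have mx i : measurable_rV (fun x : 'rV[R]_p => x 0 i) by exact: measurable_rV_coord.
have mg : measurable_rV g.
  apply: measurable_rV_expR; apply: measurable_rVB.
    apply: measurable_rVN; apply: measurable_rVM; last exact: measurable_rV_cst.
    apply: measurable_rV_quadf => i; apply: measurable_rV_subv => j.
      exact: measurable_rV_restr.
    exact: measurable_rV_cst.
  apply: measurable_rVM; first exact: measurable_rV_cst.
  apply: measurable_rV_sqr_norm2 => i; apply: measurable_rV_subv => // j.
  exact: measurable_rV_restr.
have g0 x : 0 <= g x by exact: expR_ge0.
have mcg : measurable_rV (fun x => c * g x).
  by apply: measurable_rVM => //; exact: measurable_rV_cst.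
have cg0 x : 0 <= c * g x by exact: mulr_ge0.
have := le_integral_set_rV mA (qp_density_ge0 rho0 rho1 ell omega_ge0 z delta) cg0
  (measurable_rV_qp_density rho0 rho1 omega delta mf) mcg.
rewrite (integral_rVZl c0 g0 mg) => le1.
apply: le_trans (le1 _) _; last first.
  rewrite lee_wpmul2l ?lee_fin//.
  exact: gauss_integrate_out hco hd.
move=> t /hA; set x := tuple_rV t => xC.
rewrite qp_densityE /c -[leRHS]mulrA ler_wpM2l//; first by rewrite ltW// qp_weight_gt0.
rewrite -expRD ler_expR; apply: upper_exponent; first exact: ltW.
  apply: (quadratic_expansion df a_ge0 hmax h3); first exact: restrK.
  have -> : restr delta x - h = (restr delta x - thetas) - (h - thetas).
    by rewrite opprB addrA subrK.
  apply: (le_trans (ler_norm2D _ _)); rewrite norm2N mulrDl mul1r.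
  exact: lerD.
by have /andP[] := sqr_norm2_near xC.
Qed.

(** The expansion is only valid near [h], but the ball of radius
    [(C - 1) * eps] around [h] is contained in the ball of radius [C * eps] around
    [thetas] and carries at least half of the Gaussian integral. *)
Lemma integral_qp_density_ge h :
  2 * (Num.sqrt #|S|%:R + 1) <= (C - 1) * eps * Num.sqrt kappa ->
  local_maximum_data S h ->
  ((weight S * expR (f h - rho1 / 2 * norm2 thetas ^+ 2 -
      (prior_error + rho1 / 2 * (C * eps) ^+ 2 + cubic_error S)))%:E *
   integral_rV (gauss S (- hess f h) rho0) <= 2%:E * integral_rV (dens S))%E.
Proof.
move=> hr [hmax hth h3 hco]; have [hS _] := hmax.
set c := weight S * expR _.
have c0 : 0 <= c by rewrite mulr_ge0 ?expR_ge0// ltW// qp_weight_gt0.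
pose r := (C - 1) * eps.
have C1 : 0 <= C - 1 by rewrite subr_ge0 (le_trans _ C_ge3)// ler1n.
have r0 : 0 <= r by exact: mulr_ge0 C1 (ltW eps_gt0).
have kr : 4 * (#|S|%:R + 1) <= kappa * r ^+ 2.
  have s0 : 0 <= Num.sqrt #|S|%:R :> R by exact: sqrtr_ge0.
  have s2 : Num.sqrt #|S|%:R ^+ 2 = #|S|%:R :> R by rewrite sqr_sqrtr.
  have k2 : Num.sqrt kappa ^+ 2 = kappa by rewrite sqr_sqrtr// ltW.
  rewrite -k2 -exprMn [_ * r]mulrC.
  apply: (@le_trans _ _ ((2 * (Num.sqrt #|S|%:R + 1)) ^+ 2)).
    by move: s0 s2; move: (Num.sqrt _) => b b0 <-; lra.
  rewrite lerXn2r// nnegrE; first by rewrite mulr_ge0// addr_ge0.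
  by rewrite mulr_ge0// sqrtr_ge0.
pose M := - hess f h.
pose g x := (norm2 (restr S x) <= r)%R%:R * gauss S M rho0 x.
have mx i : measurable_rV (fun x : 'rV[R]_p => x 0 i) by exact: measurable_rV_coord.
have mg : measurable_rV g.
  apply: measurable_rVM; last exact: measurable_rV_gauss.
  apply: (eq_measurable_rV (f := fun y => (norm2 (restr S y) ^+ 2 <= r ^+ 2)%R%:R)).
    by move=> y; rewrite ler_pXn2r// nnegrE norm2_ge0.
  apply: measurable_rV_ler; last exact: measurable_rV_cst.
  by apply: measurable_rV_sqr_norm2 => i; exact: measurable_rV_restr.
have g0 x : 0 <= g x by rewrite mulr_ge0 ?gauss_ge0.
have gE x : g x = (norm2 (restr S x) <= r)%R%:R * gauss S M rho0 x := erefl.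
have gb : (integral_rV (gauss S M rho0) <= 2%:E * integral_rV g)%E :=
  gauss_ball kappa_gt0 rho0_gt0 hco r0 kr.
have mcg : measurable_rV (fun x => c * g x).
  by apply: measurable_rVM => //; exact: measurable_rV_cst.
have cg0 x : 0 <= c * g x by exact: mulr_ge0.
have mcgh : measurable_rV (fun x => c * g (x - h)).
  apply: measurable_rVM; first exact: measurable_rV_cst.
  apply: (eq_measurable_rV (fun x => esym (gE (x - h)))).
  have mxh i : measurable_rV (fun x : 'rV[R]_p => (x - h) 0 i).
    by apply: measurable_rV_subv => // j; exact: measurable_rV_cst.
  apply: measurable_rVM.
    apply: (eq_measurable_rV (f := fun y => (norm2 (restr S (y - h)) ^+ 2 <= r ^+ 2)%R%:R)).
      by move=> y; rewrite ler_pXn2r// nnegrE norm2_ge0.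
    apply: measurable_rV_ler; last exact: measurable_rV_cst.
    by apply: measurable_rV_sqr_norm2 => i; exact: measurable_rV_restr.
  apply: measurable_rV_expR; apply: measurable_rVB.
    apply: measurable_rVN; apply: measurable_rVM; last exact: measurable_rV_cst.
    by apply: measurable_rV_quadf => i; exact: measurable_rV_restr.
  apply: measurable_rVM; first exact: measurable_rV_cst.
  apply: measurable_rV_sqr_norm2 => i; apply: measurable_rV_subv => // j.
  exact: measurable_rV_restr.
have le1 x : c * g (x - h) <= dens S x.
  rewrite gE; case: (leP (norm2 (restr S (x - h))) r) => [xr|_]; last first.
    by rewrite mul0r mulr0 qp_density_ge0.
  have xS : restr S (x - h) = restr S x - h by rewrite restrB hS.
  rewrite mul1r qp_densityE /c -[leLHS]mulrA ler_wpM2l//; first by rewrite ltW// qp_weight_gt0.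
  have -> : gauss S M rho0 (x - h) = expR (- (quadf M (restr S x - h) / 2)
      - rho0 / 2 * norm2 (x - restr S x) ^+ 2).
    rewrite /gauss xS; congr (expR (_ - _ * norm2 _ ^+ 2)).
    by rewrite opprB addrA subrK.
  rewrite xS in xr.
  rewrite -expRD ler_expR; apply: lower_exponent; first exact: ltW.
    apply: (quadratic_expansion df a_ge0 hmax h3); first exact: restrK.
    by apply: (le_trans xr); rewrite ler_wpM2r ?(ltW eps_gt0)// lerD2l; lra.
  have xt : norm2 (restr S x - thetas) <= C * eps.
    have -> : restr S x - thetas = (restr S x - h) + (h - thetas).
      by rewrite addrA subrK.
    apply: (le_trans (ler_norm2D _ _)); apply: (le_trans (lerD xr hth)).
    by rewrite /r; lra.
  by have /andP[] := sqr_norm2_near xt.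
have le2 : (c%:E * integral_rV g <= integral_rV (dens S))%E.
  rewrite -(integral_rVZl c0 g0 mg) -(integral_rV_shift (- h) mcg cg0).
  apply: (le_integral_rV _ le1 mcgh).
    by move=> x; exact: cg0.
  exact: measurable_rV_qp_density.
apply: (@le_trans _ _ (c%:E * (2%:E * integral_rV g))%E).
  by rewrite lee_wpmul2l ?lee_fin.
rewrite muleCA lee_wpmul2l ?lee_fin//.
Qed.

(** Bounds the logarithm of the ratio of the Gaussian integrals, over the
    coordinates in the support of [thetas], of the Hessians at the maximizers of
    two nested models: half the difference of the logarithms of their
    determinants. *)
Definition determinant_error delta : R :=
  #|S|%:R * (a * (Num.sqrt #|delta|%:R * (2 * eps)) * #|S|%:R / kappa) / 2.

(** After the excess coordinates have been integrated out, both masses are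
    Gaussian integrals over the support of [thetas], with the Hessians at [hd] and
    at [hs]. Both maximizers are within [eps] of [thetas], so the two Hessians are
    close and the two integrals comparable. *)
Lemma qp_mass_ratio delta hd hs (A : set (p.-tuple rT)) :
  2 * (Num.sqrt #|S|%:R + 1) <= (C - 1) * eps * Num.sqrt kappa ->
  S \subset delta -> local_maximum_data delta hd -> local_maximum_data S hs ->
  measurable A ->
  (forall t, A t -> norm2 (restr delta (tuple_rV t) - thetas) <= C * eps) ->
  (\int[lebesgue_tuple p]_(t in A) (dens delta (tuple_rV t))%:E <=
   (2 * (weight delta / weight S * expR (f hd - f hs)) *
    Num.sqrt (rho0 / kappa) ^+ #|delta :\: S| *
    expR (prior_error + cubic_error delta +
      (prior_error + rho1 / 2 * (C * eps) ^+ 2 + cubic_error S) +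
      determinant_error delta))%:E * integral_rV (dens S))%E.
Proof.
move=> hr Sd dd ds mA hA.
have up := integral_qp_density_le Sd dd mA hA.
have dn := integral_qp_density_ge hr ds.
have [[hdd _] hdt h3 hco] := dd; have [[hss _] hst _ hco'] := ds.
pose t := a * (Num.sqrt #|delta|%:R * (2 * eps)) * #|S|%:R / kappa.
have t0 : 0 <= t.
  by rewrite !mulr_ge0 ?invr_ge0 ?sqrtr_ge0// ?(ltW eps_gt0) ?(ltW kappa_gt0).
have hh : norm2 (hs - hd) <= 2 * eps.
  have -> : hs - hd = (hs - thetas) - (hd - thetas).
    by rewrite opprB addrA subrK.
  apply: (le_trans (ler_norm2D _ _)); rewrite norm2N.
  by apply: (le_trans (lerD hst hdt)); lra.
have cmp y : quadf (- hess f hs) (restr S y) <= (1 + t) * quadf (- hess f hd) (restr S y).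
  have kq : kappa * norm2 (restr S y) ^+ 2 <= quadf (- hess f hd) (restr S y).
    by have := hco (restr S y); rewrite restr_sub'.
  have q0 : 0 <= quadf (- hess f hd) (restr S y).
    by apply: le_trans kq; rewrite mulr_ge0 ?sqr_ge0// ltW.
  have hhC : norm2 (hs - hd) <= (C + 1) * eps.
    apply: (le_trans hh); rewrite ler_wpM2r ?(ltW eps_gt0)//.
    have C3 := C_ge3; lra.
  have hsd : restr delta hs = hs by rewrite -hss restr_sub'.
  apply: (le_trans (hess_compare df a_ge0 kappa_gt0 Sd h3 hdd hsd hhC (restrK S y) kq)).
  rewrite ler_wpM2r// lerD2l /t ler_wpM2r ?invr_ge0 ?(ltW kappa_gt0)// ler_wpM2r//.
  by rewrite ler_wpM2l// ler_wpM2l// sqrtr_ge0.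
have comp := gauss_compare rho0 t0 cmp.
have chain := mule_chain _ _ _ _ up comp dn.
apply: (le_trans (chain _ _ _ _)).
- by rewrite mulr_ge0 ?expR_ge0// ltW// qp_weight_gt0.
- by rewrite exprn_ge0// sqrtr_ge0.
- exact: expR_ge0.
- by rewrite mulr_gt0 ?expR_gt0// qp_weight_gt0.
by rewrite ratio_exponent.
Qed.

End mass_ratio.

(** * Prior weights and error terms *)

Section prior_weights.
Context {R : realType} {p : nat}.
Implicit Types (S delta : {set 'I_p}).

Lemma powR_half (x : R) n : 0 <= x -> x `^ (n%:R / 2) = Num.sqrt x ^+ n.
Proof. by move=> x0; rewrite mulrC powRrM powR12_sqrt// powR_mulrn// sqrtr_ge0. Qed.

(** The normalizing constants of the spike-and-slab prior turn the factors
    [sqrt (rho0 / kappa)] left by the integration of the excess coordinates into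
    [sqrt (rho1 / kappa)]: the spike precision [rho0] cancels. *)
Lemma qp_weight_ratio (rho0 rho1 q kappa : R) S delta :
  0 < rho0 -> 0 < rho1 -> 0 < q -> q < 1 -> 0 < kappa -> S \subset delta ->
  let w := qp_weight rho0 rho1 (bernoulli_prior q) in
  w delta / w S * Num.sqrt (rho0 / kappa) ^+ #|delta :\: S| =
  (q / (1 - q) * Num.sqrt (rho1 / kappa)) ^+ #|delta :\: S|.
Proof.
move=> r0 r1 q0 q1 k0 Sd /=.
have pi2 : 0 < 2 * pi :> R by rewrite mulr_gt0// pi_gt0.
have a0 : 0 < Num.sqrt (rho1 / (2 * pi)) by rewrite sqrtr_gt0 divr_gt0.
have b0 : 0 < Num.sqrt (rho0 / (2 * pi)) by rewrite sqrtr_gt0 divr_gt0.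
have q10 : 0 < 1 - q by rewrite subr_gt0.
rewrite /qp_weight /bernoulli_prior !powR_half ?divr_ge0 ?ltW//.
set k := #|delta :\: S|.
have dk : #|delta| = (#|S| + k)%N by rewrite /k cardsD (finset.setIidPr Sd) subnKC// subset_leq_card.
have pk : (p - #|S| = p - #|delta| + k)%N.
  have : (#|delta| <= p)%N by rewrite -[X in (_ <= X)%N]card_ord max_card.
  rewrite dk => h; rewrite subnDA subnK// leq_subRL//.
  exact: leq_trans (leq_addr _ _) h.
rewrite pk dk !exprD !exprMn exprVn.
have -> : Num.sqrt (rho0 / kappa) = Num.sqrt (rho0 / (2 * pi)) * Num.sqrt (2 * pi / kappa).
  rewrite -sqrtrM ?divr_ge0 ?ltW//; congr Num.sqrt.
  by rewrite mulrA divfK// gt_eqF.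
have -> : Num.sqrt (rho1 / kappa) = Num.sqrt (rho1 / (2 * pi)) * Num.sqrt (2 * pi / kappa).
  rewrite -sqrtrM ?divr_ge0 ?ltW//; congr Num.sqrt.
  by rewrite mulrA divfK// gt_eqF.
set A := Num.sqrt (rho1 / _); set B := Num.sqrt (rho0 / _); set D := Num.sqrt (2 * pi / _).
rewrite !exprMn !invfM.
set qs := q ^+ #|S|; set qk := q ^+ k; set m := (1 - q) ^+ (p - _).
set mk := (1 - q) ^+ k; set As := A ^+ #|S|; set Ak := A ^+ k.
set Bs := B ^+ (p - _); set Bk := B ^+ k; set Dk := D ^+ k.
have e1 : qs * qs^-1 = 1 by rewrite divff// gt_eqF// exprn_gt0.
have e2 : m * m^-1 = 1 by rewrite divff// gt_eqF// exprn_gt0.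
have e3 : As * As^-1 = 1 by rewrite divff// gt_eqF// exprn_gt0.
have e4 : Bs * Bs^-1 = 1 by rewrite divff// gt_eqF// exprn_gt0.
have e5 : Bk * Bk^-1 = 1 by rewrite divff// gt_eqF// exprn_gt0.
transitivity ((qs * qs^-1) * (m * m^-1) * (As * As^-1) * (Bs * Bs^-1) * (Bk * Bk^-1)
  * (qk * mk^-1 * (Ak * Dk))); first by lra.
by rewrite e1 e2 e3 e4 e5 !mul1r.
Qed.

(** Summing over the supermodels of [S] amounts to expanding the product of the
    factors [1 + p^-1] over the coordinates outside [S], which is at most
    [(1 + p^-1) ^+ p]. *)
Lemma sum_supermodels_le S :
  \sum_(delta : {set 'I_p} | S \subset delta) (p%:R^-1 : R) ^+ #|delta :\: S| <= expR 1.
Proof.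
pose y : R := p%:R^-1.
pose F (i : 'I_p) : R := if i \in S then 1 else y.
pose G (i : 'I_p) : R := if i \in S then 0 else 1.
have -> : \sum_(delta : {set 'I_p} | S \subset delta) y ^+ #|delta :\: S| =
    \prod_(i < p) (F i + G i).
  rewrite bigA_distr big_mkcond/=; apply: eq_big => // J _.
  case: ifPn => [SJ|/subsetPn[i iS iJ]]; last first.
    by rewrite (bigD1 i)//= (negbTE iJ) /G iS mul0r.
  rewrite -prodr_const big_mkcond/=; apply: eq_bigr => i _.
  rewrite inE /F /G; have := fintype.subsetP SJ i.
  case: (i \in S) => /= [->//|_]; by case: (i \in J).
apply: (@le_trans _ _ (\prod_(i < p) expR y)).
  apply: ler_prod => i _; rewrite /F /G; case: (i \in S).
    by rewrite addr0 ler01/= -expR0 ler_expR invr_ge0.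
  by rewrite addr_ge0 ?invr_ge0//= addrC expR_ge1Dx.
rewrite -expR_sum sumr_const card_ord -mulr_natr ler_expR /y.
have [->|p0] := posnP p; first by rewrite mulr0.
by rewrite mulVf// pnatr_eq0 -lt0n.
Qed.

End prior_weights.

Section error_bound.
Context {R : realType} {p : nat}.
Variables (rho1 : R) (thetas : 'rV[R]_p) (C eps kappa a : R).
Local Notation S := (supp thetas).

(** As [C * eps] is at most the size of [thetas], the second-order prior term
    [rho1 * (C * eps) ^+ 2] is at most of the order of the first-order one. *)
Lemma total_error_le (sbar : nat) (delta : {set 'I_p}) : 0 < rho1 -> 3 <= C -> 0 < eps ->
  0 < kappa -> 0 <= a -> C * eps <= `|thetas| ->
  (0 < #|S|)%N -> (#|S| <= sbar)%N -> (#|delta| <= sbar)%N ->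
  prior_error rho1 thetas C eps + cubic_error C eps a delta +
    (prior_error rho1 thetas C eps + rho1 / 2 * (C * eps) ^+ 2 + cubic_error C eps a S) +
    determinant_error thetas eps kappa a delta <=
  (C + 1) ^+ 3 * (rho1 * `|thetas| * Num.sqrt sbar%:R * eps +
    a * (sbar%:R `^ (3 / 2) * eps ^+ 3)) +
  2 * a * (sbar%:R ^+ 3 * eps / kappa).
Proof.
move=> r1 C3 e0 k0 a0 Ce s0 ss ds.
have -> : sbar%:R `^ (3 / 2) = Num.sqrt sbar%:R ^+ 3 :> R by rewrite powR_half.
set b := Num.sqrt sbar%:R; set t := `|thetas|.
have b1 : 1 <= b by rewrite -[leLHS]sqrtr1 ler_wsqrtr// ler1n (leq_trans s0).
have b2 : b ^+ 2 = sbar%:R by rewrite sqr_sqrtr.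
have t0 : 0 <= t by exact: normr_ge0.
have sb n : (n <= sbar)%N -> Num.sqrt n%:R <= b :> R.
  by move=> nb; rewrite ler_wsqrtr// ler_nat.
have C10 : 0 <= C + 1 by lra.
have C27 : 3 * C <= (C + 1) ^+ 3.
  have : 0 <= C ^+ 3 by rewrite exprn_ge0//; lra.
  have : 0 <= C ^+ 2 by exact: sqr_ge0.
  by lra.
have b0 : 0 <= b by exact: sqrtr_ge0.
have C0 : 0 <= C by lra.
have r1w := ltW r1; have e0w := ltW e0; have k0w := ltW k0.
(* each of the three prior terms is at most [C * P] *)
pose P := rho1 * t * b * eps.
have P0 : 0 <= P by rewrite /P !mulr_ge0.
have prior : prior_error rho1 thetas C eps <= C * P.
  rewrite /prior_error -/t.
  have -> : C * P = rho1 * (t * b * (C * eps)) by rewrite /P; lra.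
  by rewrite ler_wpM2l// ler_wpM2r ?mulr_ge0// ler_wpM2l// sb.
have prior2 : rho1 / 2 * (C * eps) ^+ 2 <= C * P.
  have h1 : (C * eps) ^+ 2 <= C * eps * (t * b).
    rewrite expr2 ler_wpM2l ?mulr_ge0//.
    by apply: (le_trans Ce); rewrite -[leLHS]mulr1 ler_wpM2l.
  have h2 : rho1 * (C * eps) ^+ 2 <= rho1 * (C * eps * (t * b)) by rewrite ler_wpM2l.
  have h3 : 0 <= C * P by rewrite mulr_ge0.
  have -> : C * P = rho1 * (C * eps * (t * b)) by rewrite /P; lra.
  have h4 : 0 <= rho1 * (C * eps) ^+ 2 by rewrite mulr_ge0 ?sqr_ge0.
  by lra.
pose V := a * (b ^+ 3 * eps ^+ 3).
have V0 : 0 <= V by rewrite /V !mulr_ge0 ?exprn_ge0.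
have cubic (T : {set 'I_p}) : (#|T| <= sbar)%N -> cubic_error C eps a T <= (C + 1) ^+ 3 * V / 6.
  move=> Tb; rewrite /cubic_error.
  have -> : (C + 1) ^+ 3 * V / 6 = a / 6 * (b * ((C + 1) * eps)) ^+ 3.
    by rewrite /V !exprMn; lra.
  have Ce0 : 0 <= (C + 1) * eps by rewrite mulr_ge0.
  rewrite ler_wpM2l ?divr_ge0// lerXn2r ?nnegrE ?mulr_ge0 ?sqrtr_ge0//.
  by rewrite ler_wpM2r// sb.
have det : determinant_error thetas eps kappa a delta <= a * (sbar%:R ^+ 3 * eps / kappa).
  rewrite /determinant_error.
  have n0 : 0 <= #|S|%:R :> R by [].
  have n1 : #|S|%:R <= sbar%:R :> R by rewrite ler_nat.
  have m1 : Num.sqrt #|delta|%:R <= sbar%:R :> R.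
    by apply: (le_trans (sb _ ds)); rewrite -b2 expr2 -[leLHS]mulr1 ler_wpM2l//; lra.
  have -> : #|S|%:R * (a * (Num.sqrt #|delta|%:R * (2 * eps)) * #|S|%:R / kappa) / 2 =
     (a * (eps / kappa)) * (#|S|%:R * #|S|%:R * Num.sqrt #|delta|%:R).
    by set X := Num.sqrt _; set Y := #|S|%:R; lra.
  have -> : a * (sbar%:R ^+ 3 * eps / kappa) = (a * (eps / kappa)) * (sbar%:R * sbar%:R * sbar%:R).
    by set Y := sbar%:R; lra.
  rewrite ler_wpM2l ?mulr_ge0 ?invr_ge0 ?(ltW e0) ?(ltW k0)//.
  by rewrite ler_pM ?mulr_ge0 ?sqrtr_ge0// ler_pM.
have W0 : 0 <= a * (sbar%:R ^+ 3 * eps / kappa).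
  by rewrite !mulr_ge0 ?exprn_ge0 ?invr_ge0 ?(ltW e0) ?(ltW k0).
have hP := ler_wpM2r P0 C27.
have hV : 0 <= (C + 1) ^+ 3 * V by rewrite mulr_ge0// exprn_ge0.
have c1 := cubic _ ds; have c2 := cubic _ ss.
rewrite -/P -/V.
move: prior prior2 c1 c2 det W0 hP hV.
move: (prior_error _ _ _ _) (cubic_error _ _ _ delta) (cubic_error _ _ _ S)
  (determinant_error _ _ _ _ _) (rho1 / 2 * _) ((C + 1) ^+ 3) => x1 x2 x3 x4 x5 x6.
by move: (sbar%:R ^+ 3 * eps / kappa) => x7; lra.
Qed.

End error_bound.

(** * Maximizers and third derivatives of the sparse log-likelihoods *)

Lemma card_supp_gt0 (R : realType) (p : nat) (x : 'rV[R]_p) :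
  x != 0 -> (0 < #|supp x|)%N.
Proof.
move=> x0; rewrite lt0n cards_eq0; apply: contraNneq x0 => S0.
apply/eqP/rowP => i; rewrite mxE; apply/eqP.
have : i \notin supp x by rewrite S0 finset.in_set0.
by rewrite inE negbK.
Qed.

Section near_truth.
Context {R : realType} {p : nat} {Z : Type}.
Variables (rho0 rho1 : R) (omega : {set 'I_p} -> R) (ell : 'rV[R]_p -> Z -> R).
Variables (thetas : 'rV[R]_p) (rhobar kappabar : R) (r : R -> R) (sbar : nat).
Local Notation S := (supp thetas).
Hypothesis rhobar_gt0 : 0 < rhobar.

Lemma rate_eps_ge0 : (0 <= rate_eps thetas rhobar r sbar)%E.
Proof. by apply/ereal_infP => _ [y [y0 _] <-]; rewrite lee_fin ltW. Qed.

Lemma rate_eps_gt (x : R) : (rate_eps thetas rhobar r sbar < +oo)%E ->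
  fine (rate_eps thetas rhobar r sbar) < x ->
  0 < x /\ 2 * Num.sqrt (#|S| + sbar)%:R * rhobar * x <= r x.
Proof.
move=> eoo; rewrite -lte_fin fineK; last by rewrite ge0_fin_numE// rate_eps_ge0.
move=> /ereal_inf_lt[_ [y [y0 hy] <-]]; rewrite lte_fin => yx.
by split; [exact: lt_trans yx|rewrite -subr_ge0 hy// ltW].
Qed.

(** The log-likelihood at [h] is at least that at [thetas], so the linear term,
    at most [rhobar / 2] times an l1 norm, must compensate the curvature
    [r (norm2 (h - thetas)) / 2]. Beyond [rate_eps] the curvature wins. *)
Lemma maximizer_near_truth z (delta : {set 'I_p}) h :
  (rate_eps thetas rhobar r sbar < +oo)%E -> (0 < #|S|)%N ->
  event1 rho0 rho1 omega ell thetas rhobar kappabar r sbar z ->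
  (#|delta| <= sbar)%N -> S \subset delta ->
  maximizes_on (ell ^~ z) delta h ->
  norm2 (h - thetas) <= fine (rate_eps thetas rhobar r sbar).
Proof.
move=> eoo S0 [[_ hgrad _] hcurv] ds Sd [hh hmax].
have ts : restr delta thetas = thetas.
  apply/rowP => i; rewrite restrEx; case: ifPn => // id; apply/eqP.
  have := contra (fintype.subsetP Sd i) id.
  by rewrite inE negbK eq_sym.
rewrite leNgt; apply/negP => /(rate_eps_gt eoo)[].
set x := norm2 _ => x0 rx.
have := hcurv delta h ds (ex_intro2 _ _ h I hh).
rewrite /bregman -/x => hb.
have dfh : 0 <= ell h z - ell thetas z by rewrite subr_ge0; exact: hmax.
set g := grad _ _ in hb hgrad.
have hg : dotv g (h - thetas) <= rhobar / 2 * norm1 (h - thetas).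
  rewrite /dotv /norm1 mulr_sumr; apply: ler_sum => i _.
  apply: (le_trans (ler_norm _)); rewrite normrM ler_wpM2r//.
  exact: le_trans (ler_coord_norm g i) hgrad.
have n1 : norm1 (h - thetas) <= Num.sqrt #|delta|%:R * x.
  have hd : restr delta (h - thetas) = h - thetas by rewrite restrB hh ts.
  by rewrite -hd; apply: (le_trans (norm1_restr _ _)); rewrite hd.
have n2 : Num.sqrt #|delta|%:R * x <= Num.sqrt (#|S| + sbar)%:R * x.
  by rewrite ler_wpM2r ?(ltW x0)// ler_wsqrtr// ler_nat (leq_trans ds)// leq_addl.
have b0 : 0 < Num.sqrt (#|S| + sbar)%:R :> R.
  by rewrite sqrtr_gt0 ltr0n addn_gt0 S0.
have bx : 0 < rhobar * (Num.sqrt (#|S| + sbar)%:R * x) by rewrite !mulr_gt0.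
have n12 := ler_wpM2l (ltW rhobar_gt0) (le_trans n1 n2).
move: rx hb dfh hg bx n12.
move: (Num.sqrt (#|S| + sbar)%:R) (norm1 _) (dotv _ _) (ell h z - ell thetas z) (r x).
by move=> b n d e rx; lra.
Qed.

End near_truth.

Section third_derivatives.
Context {R : realType} {p : nat} {Z : Type}.
Variables (ell : 'rV[R]_p -> Z -> R) (thetas : 'rV[R]_p) (sbar : nat).
Variable thetahat : forall delta : {set 'I_p}, Z -> 'rV[R]_#|delta|.
Local Notation S := (supp thetas).

Lemma a2_ge0 (rad : R) z : thetas != 0 -> (#|S| <= sbar)%N -> 0 <= rad ->
  (0 <= a2 ell thetas sbar thetahat rad z)%E.
Proof.
move=> t0 ss rad0.
have s0 := card_supp_gt0 t0.
pose k := Ordinal s0.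
pose D3 := partial k (partial k (partial k (fun w : 'rV[R]_#|S| => ellsub ell w z))).
apply: (@le_trans _ _ (`|D3 (thetahat S z)|%:E)); first by rewrite lee_fin.
apply: (@le_trans _ _ (varpi ell thetahat S rad z)).
  apply: ereal_sup_ubound; exists (k, k, k) => //; exists (thetahat S z) => //=.
  by rewrite subrr /norm2 /dotv big1 ?sqrtr0// => i _; rewrite mxE mul0r.
by apply: ereal_sup_ubound; exists S.
Qed.

Lemma third_order_bound_a2 (rad a : R) z (delta : {set 'I_p}) :
  times_differentiable 3 (ell ^~ z) -> supermodels thetas sbar delta ->
  (a2 ell thetas sbar thetahat rad z <= a%:E)%E ->
  third_order_bound (ell ^~ z) delta (embed (thetahat delta z)) rad a.
Proof.
move=> df hd ha x u v w hx xr hu hv hw.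
have dF := @times_differentiable_embed _ _ delta _ _ df.
rewrite -[u](selectK hu) -[v](selectK hv) -[w](selectK hw) -(selectK hx).
set w' := select delta w; set v' := select delta v; set u' := select delta u.
have E1 : (fun y : 'rV[R]_#|delta| => 'D_(embed w') (ell ^~ z) (embed y)) =
    'D_w' (fun y => ell (embed y) z).
  by apply/funext => y; rewrite (derive_embed (ell ^~ z)).
have E2 : (fun y : 'rV[R]_#|delta| => 'D_(embed v') ('D_(embed w') (ell ^~ z)) (embed y)) =
    'D_v' ('D_w' (fun y => ell (embed y) z)).
  apply/funext => y; rewrite -E1.
  exact: esym (derive_embed ('D_(embed w') (ell ^~ z)) y v').
rewrite -(derive_embed ('D_(embed v') ('D_(embed w') (ell ^~ z)))) E2 !norm1_embed.
apply: (norm_derive3_le (F := fun y => ell (embed y) z) _ _ _ dF) => i j k.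
have wr : norm2 (select delta x - thetahat delta z) <= rad.
  by rewrite -norm2_embed linearB/= (selectK hx).
rewrite -lee_fin; apply: le_trans ha.
apply: (@le_trans _ _ (varpi ell thetahat delta rad z)).
  apply: ereal_sup_ubound.
  exact: (ex_intro2 _ _ (i, j, k) I (ex_intro2 _ _ (select delta x) wr erefl)).
apply: ereal_sup_ubound; exact: (ex_intro2 _ _ delta hd erefl).
Qed.

Lemma coercive_embed z (delta : {set 'I_p}) (w : 'rV[R]_#|delta|) (kappa : R) :
  times_differentiable 3 (ell ^~ z) ->
  (forall v : 'rV[R]_#|delta|, v != 0 ->
    kappa <= quadf (- hess (fun w' : 'rV[R]_#|delta| => ellsub ell w' z) w) v / norm2 v ^+ 2) ->
  coercive delta (- hess (ell ^~ z) (embed w)) kappa.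
Proof.
move=> df hk x.
have d2 n (F : 'rV[R]_n -> R) : times_differentiable 3 F -> times_differentiable 2 F.
  by case=> ? h3; split => // y; case: (h3 y) => ? h4; split => // y'; case: (h4 y').
have dF := @times_differentiable_embed _ _ delta _ _ df.
pose v := select delta (restr delta x).
have vE : embed v = restr delta x by apply: selectK; exact: restrK.
have [v0|v0] := eqVneq v 0.
  have -> : restr delta x = 0 by rewrite -vE v0 linear0.
  by rewrite -(scale0r (0 : 'rV[R]_p)) quadfZ norm2Z normr0 !expr0n/= !mul0r expr0n/= mulr0.
have := hk v v0; rewrite ler_pdivlMr; last first.
  by rewrite exprn_gt0// lt_neqAle norm2_ge0 eq_sym norm2_eq0 v0.
rewrite -norm2_embed vE => /le_trans; apply.
rewrite -[leLHS]opprK -(derive2_quadf_hess w v (d2 _ _ dF)).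
rewrite -[leRHS]opprK -(derive2_quadf_hess _ _ (d2 _ _ df)) -vE.
have -> : 'D_v (fun y => ell (embed y) z) = (fun y => 'D_(embed v) (ell ^~ z) (embed y)).
  by apply/funext => y; rewrite (derive_embed (ell ^~ z)).
by rewrite (derive_embed ('D_(embed v) (ell ^~ z))).
Qed.

End third_derivatives.

(** * Posterior masses *)

Section slices.
Context {R : realType} {p : nat}.
Local Notation rT := (measurableTypeR R).
Implicit Types (delta : {set 'I_p}) (A B : set ({set 'I_p} * 'rV[R]_p)).

Definition slice A delta : set (p.-tuple rT) := [set t | A (delta, tuple_rV t)].

Definition measurable_slices A : Prop := forall delta, measurable (slice A delta).

Lemma measurable_sublevel (h : 'rV[R]_p -> 'rV[R]_p) (c : R) :
  (forall i, measurable_rV (fun x => h x 0 i)) ->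
  measurable [set t : p.-tuple rT | norm2 (h (tuple_rV t)) <= c].
Proof.
move=> mh; have [c0|c0] := leP 0 c; last first.
  rewrite (_ : [set _ | _] = set0)//; apply/seteqP; split => // t /= tc.
  by have := lt_le_trans c0 (norm2_ge0 (h (tuple_rV t))); rewrite ltNge tc.
rewrite (_ : [set _ | _] = (fun t : p.-tuple rT => norm2 (h (tuple_rV t)) ^+ 2) @^-1`
    `]-oo, c ^+ 2]%classic).
  rewrite -[X in measurable X]setTI.
  apply: (measurable_rV_sqr_norm2 mh) => //; exact: measurable_itv.
by apply/seteqP; split => t /=; rewrite in_itv/= ler_pXn2r// nnegrE norm2_ge0.
Qed.

Lemma measurable_Bmodel (rho0 : R) (thetas : 'rV[R]_p) (C C1 eps : R) delta :
  measurable [set t : p.-tuple rT | Bmodel rho0 thetas C C1 eps delta (tuple_rV t)].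
Proof.
have mx i : measurable_rV (fun x : 'rV[R]_p => x 0 i) by exact: measurable_rV_coord.
apply: (measurableI _ _ (@measurable_sublevel (fun x => restr delta x - thetas) _ _)
    (@measurable_sublevel (fun x => x - restr delta x) _ _)) => i.
  apply: measurable_rV_subv => j; first exact: measurable_rV_restr.
  exact: measurable_rV_cst.
by apply: measurable_rV_subv => // j; exact: measurable_rV_restr.
Qed.

Lemma measurable_slices_bigcup (D : set {set 'I_p}) (F : {set 'I_p} -> set 'rV[R]_p) :
  (forall delta, measurable [set t : p.-tuple rT | F delta (tuple_rV t)]) ->
  measurable_slices (\bigcup_(delta in D) ([set delta] `*` F delta)).
Proof.
move=> mF delta; have [dD|dD] := pselect (D delta).
  rewrite (_ : slice _ _ = [set t | F delta (tuple_rV t)]); first exact: mF.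
  apply/seteqP; split => t /=; first by case=> d _ [/= -> ].
  by move=> Ft; exists delta.
rewrite (_ : slice _ _ = set0)//; apply/seteqP; split => // t.
by case=> d dD' [/= E]; move: dD; rewrite E.
Qed.

End slices.

Section masses.
Context {R : realType} {p : nat} {Z : Type}.
Variables (rho0 rho1 : R) (omega : {set 'I_p} -> R) (ell : 'rV[R]_p -> Z -> R) (z : Z).
Local Notation rT := (measurableTypeR R).
Local Notation dens := (qp_density rho0 rho1 omega ell z).
Local Notation mass := (qp_mass rho0 rho1 omega ell z).
Implicit Types (delta : {set 'I_p}) (A B : set ({set 'I_p} * 'rV[R]_p)).
Hypotheses (omega_ge0 : forall delta, 0 <= omega delta)
  (mell : measurable_rV (ell ^~ z)).
Local Open Scope ereal_scope.

Let dens0 delta (t : p.-tuple rT) : 0 <= (dens delta (tuple_rV t))%:E.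
Proof. by rewrite lee_fin; exact: qp_density_ge0. Qed.

Let mdens delta (A : set (p.-tuple rT)) :
  measurable_fun A (fun t : p.-tuple rT => (dens delta (tuple_rV t))%:E).
Proof.
apply: measurable_funTS; apply/measurable_EFinP.
exact: measurable_rV_qp_density.
Qed.

Lemma qp_mass_ge0 A : 0 <= mass A.
Proof. by apply: sume_ge0 => delta _; apply: integral_ge0 => t _; exact: dens0. Qed.

Lemma qp_mass_le A : measurable_slices A -> mass A <= mass setT.
Proof.
move=> mA; apply: lee_sum => delta _; apply: ge0_subset_integral => //.
  exact: mA.
exact: measurableT.
Qed.

Lemma qp_mass_setT_ge delta : integral_rV (dens delta) <= mass setT.
Proof.
rewrite /qp_mass (bigD1 delta)//=.
rewrite (_ : [set _ | _] = setT); last by apply/seteqP; split.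
rewrite -[leLHS]adde0; apply: leeD; first exact: lexx.
by apply: sume_ge0 => d _; apply: integral_ge0 => t _; exact: dens0.
Qed.

(** No inclusion of [A] in [B] is assumed: it fails for the sets considered below
    as soon as the bound on the model sizes in [A] exceeds the one in [B]. *)
Lemma qp_mass_split A B : measurable_slices A -> measurable_slices B ->
  mass setT <= mass A + mass (~` B) +
    \sum_(delta : {set 'I_p}) \int[lebesgue_tuple p]_(t in slice (B `\` A) delta)
      (dens delta (tuple_rV t))%:E.
Proof.
move=> mA mB; rewrite /qp_mass -!big_split/=; apply: lee_sum => delta _.
rewrite -/(slice A delta) -/(slice (~` B) delta).
set X := slice A delta; set Y := slice B delta.
have mX : measurable X by exact: mA.
have mY : measurable Y by exact: mB.
have -> : slice (~` B) delta = ~` Y by [].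
have -> : slice (B `\` A) delta = Y `\` X by [].
have -> : [set t : p.-tuple rT | [set: {set 'I_p} * 'rV[R]_p] (delta, tuple_rV t)] =
    X `|` ((~` X `&` ~` Y) `|` (Y `\` X)).
  apply/seteqP; split => // t _.
  have [tX|tX] := pselect (X t); first by left.
  by right; have [tY|tY] := pselect (Y t); [right|left].
have mXC := measurableC mX; have mYC := measurableC mY.
have mXY := measurableI _ _ mXC mYC; have mYX := measurableD mY mX.
rewrite ge0_integral_setU//; [|exact: measurableU|]; last first.
  by apply/disj_setPS => t [tX [[]//|[_]//]].
rewrite ge0_integral_setU//; last first.
  by apply/disj_setPS => t [[_ tY] []].
rewrite addeA; apply: leeD; last exact: lexx.
apply: leeD; first exact: lexx.
apply: ge0_subset_integral => //.
Qed.

End masses.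

Section model_ratio.
Context {R : realType}.

Lemma expR1_le4 : expR 1 <= 4 :> R.
Proof.
have h : 3 / 4 <= expR (- (1 / 4)) :> R.
  by apply: le_trans (expR_ge1Dx _); lra.
have : (3 / 4) ^+ 4 <= expR (- (1 / 4)) ^+ 4 :> R.
  by rewrite lerXn2r// nnegrE ?expR_ge0//; lra.
rewrite -expRM_natl (_ : 4%:R * - (1 / 4) = - 1); last by lra.
rewrite expRN => h4; rewrite -[leRHS]invrK -[leLHS]invrK lef_pV2 ?posrE ?invr_gt0 ?expR_gt0//.
by apply: le_trans h4; lra.
Qed.

(** The prior odds [p ^ -(u + 1)] of one more selected coordinate absorb the
    overfitting gain [p ^ (u / 2)] and leave [p ^ -1], which pays for the choice
    of the coordinate, times [p ^ (-u / 2)]. *)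
Lemma model_ratio_le (p k m : nat) (u q rho1 kappa d : R) :
  (0 < p)%N -> 0 < rho1 -> 0 < kappa ->
  q / (1 - q) = 1 / p%:R `^ (u + 1) ->
  4 * rho1 <= kappa * p%:R `^ u ->
  (m <= k)%N -> d <= k%:R * u / 2 * ln p%:R ->
  (q / (1 - q) * Num.sqrt (rho1 / kappa)) ^+ k * expR d <=
  p%:R^-1 ^+ k * (Num.sqrt (rho1 / kappa) * (1 / p%:R `^ (u / 2))) ^+ m.
Proof.
move=> p0 r0 k0 qE hk mk hd.
have pR0 : 0 < p%:R :> R by rewrite ltr0n.
pose P := p%:R `^ (u / 2) : R.
have P0 : 0 < P by exact: powR_gt0.
have pu : p%:R `^ u = P ^+ 2 :> R.
  rewrite /P -powR_mulrn ?powR_ge0// -powRrM; congr (_ `^ _); lra.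
have pu1 : p%:R `^ (u + 1) = P ^+ 2 * p%:R :> R.
  rewrite powRD; last by apply/implyP => _; rewrite gt_eqF.
  by rewrite pu powRr1// ltW.
have dP : expR d <= P ^+ k.
  rewrite /P /powR gt_eqF// -expRM_natl ler_expR; apply: (le_trans hd); lra.
set sq := Num.sqrt (rho1 / kappa).
have sq0 : 0 <= sq by exact: sqrtr_ge0.
pose x := sq * (1 / P).
have x0 : 0 <= x by rewrite mulr_ge0// divr_ge0// ltW.
have x1 : x <= 1.
  have rk0 : 0 <= rho1 / kappa by rewrite divr_ge0// ltW.
  rewrite -(@ler_pXn2r _ 2)// ?nnegrE// expr1n /x exprMn sqr_sqrtr//.
  rewrite div1r exprVn ler_pdivrMr ?exprn_gt0// mul1r ler_pdivrMr// -pu.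
  by rewrite mulrC; apply: le_trans hk; lra.
have E : q / (1 - q) * sq * P = p%:R^-1 * x.
  rewrite qE pu1 /x expr2 !div1r !invfM.
  have PP : P * P^-1 = 1 by rewrite divff// gt_eqF.
  transitivity (p%:R^-1 * (sq * P^-1) * (P * P^-1)); first by lra.
  by rewrite PP mulr1.
have c0 : 0 <= q / (1 - q) * sq.
  by rewrite mulr_ge0// qE divr_ge0// powR_ge0.
apply: (@le_trans _ _ ((q / (1 - q) * sq) ^+ k * P ^+ k)).
  by rewrite ler_wpM2l// exprn_ge0.
rewrite -exprMn E exprMn ler_wpM2l ?exprn_ge0 ?invr_ge0//.
by rewrite -(subnK mk) exprD -[leRHS]mul1r ler_wpM2r ?exprn_ge0// exprn_ile1.
Qed.

End model_ratio.

(** * Posterior mass of the models that are too large *)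

Section selection.
Context {R : realType} {p : nat} {Z : Type}.
Variables (rho0 rho1 q u : R) (ell : 'rV[R]_p -> Z -> R) (z : Z).
Variables (thetas : 'rV[R]_p) (C C1 eps kappa a : R) (sbar j : nat).
Variable h : {set 'I_p} -> 'rV[R]_p.
Local Notation rT := (measurableTypeR R).
Local Notation f := (ell ^~ z).
Local Notation S := (supp thetas).
Local Notation omega := (bernoulli_prior q).
Local Notation dens := (qp_density rho0 rho1 omega ell z).
Local Notation mass := (qp_mass rho0 rho1 omega ell z).
Local Notation post := (quasi_post rho0 rho1 omega ell z).
Local Notation B := (Ball rho0 thetas C C1 eps sbar).
Local Notation Bj := (Bsup rho0 thetas C C1 eps j).
Implicit Types (delta : {set 'I_p}).
Hypotheses (rho0_gt0 : 0 < rho0) (rho1_gt0 : 0 < rho1) (q_gt0 : 0 < q) (q_lt1 : q < 1)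
  (df : times_differentiable 3 f) (mf : measurable_rV f)
  (C_ge3 : 3 <= C) (eps_gt0 : 0 < eps) (kappa_gt0 : 0 < kappa) (a_ge0 : 0 <= a)
  (p_gt0 : (0 < p)%N) (S_gt0 : (0 < #|S|)%N) (S_le : (#|S| <= sbar)%N)
  (beta_min : forall i, i \in S -> C * eps < `|thetas 0 i|)
  (q_odds : q / (1 - q) = 1 / p%:R `^ (u + 1))
  (kappa_large : 4 * rho1 <= kappa * p%:R `^ u)
  (curvature : 2 * (Num.sqrt #|S|%:R + 1) <= (C - 1) * eps * Num.sqrt kappa)
  (well_defined : qp_well_defined rho0 rho1 omega ell z)
  (data : forall delta, S \subset delta -> (#|delta| <= sbar)%N ->
    local_maximum_data ell z thetas C eps kappa a delta (h delta))
  (gain : forall delta, S \subset delta -> (#|delta| <= sbar)%N -> (#|S| < #|delta|)%N ->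
    f (h delta) - f (h S) <= #|delta :\: S|%:R * u / 2 * ln p%:R).

Let omega_gt0 delta : 0 < omega delta.
Proof. by rewrite /bernoulli_prior mulr_gt0// exprn_gt0// subr_gt0. Qed.

Let omega_ge0 delta : 0 <= omega delta. Proof. exact: ltW. Qed.

Definition exponent_bound : R :=
  (C + 1) ^+ 3 * (rho1 * `|thetas| * Num.sqrt sbar%:R * eps +
    a * (sbar%:R `^ (3 / 2) * eps ^+ 3)) +
  2 * a * (sbar%:R ^+ 3 * eps / kappa).

Definition model_factor : R := Num.sqrt (rho1 / kappa) * (1 / p%:R `^ (u / 2)).

Lemma model_factor_ge0 : 0 <= model_factor.
Proof. by rewrite mulr_ge0 ?sqrtr_ge0// divr_ge0// powR_ge0. Qed.

(** A vector that misses a component of [thetas] is at a distance from [thetas] at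
    least the size of this component. *)
Lemma Bmodel_supp delta theta :
  Bmodel rho0 thetas C C1 eps delta theta -> S \subset delta.
Proof.
move=> [hb _]; apply/fintype.subsetP => i iS; apply/negPn/negP => id.
have := beta_min iS; apply/negP; rewrite -leNgt; apply: le_trans hb.
apply: le_trans (ler_coord_norm2 _ i).
by rewrite mxE restrEx (negbTE id) add0r mxE normrN.
Qed.

Lemma slice_diff delta t : slice (B `\` Bj) delta t ->
  [/\ S \subset delta, (#|delta| <= sbar)%N, (#|S| + j < #|delta|)%N &
    Bmodel rho0 thetas C C1 eps delta (tuple_rV t)].
Proof.
move=> [[d ds [/= dE Bt]] nBj].
rewrite -dE in ds Bt.
have Sd := Bmodel_supp Bt; split => //.
rewrite ltnNge; apply/negP => dj; apply: nBj.
by exists delta.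
Qed.

Let mBj : measurable_slices Bj.
Proof. by apply: measurable_slices_bigcup => d; exact: measurable_Bmodel. Qed.

Let mB : measurable_slices B.
Proof. by apply: measurable_slices_bigcup => d; exact: measurable_Bmodel. Qed.

(** A model in this slice has [k > j] excess coordinates. Its prior odds, its
    likelihood gain and the Gaussian factors left by the excess coordinates
    combine as in [model_ratio_le], where [j + 1] factors [model_factor] are kept;
    the factor [p ^ -k] is left for the summation over models. *)
Lemma slice_mass_le delta :
  (\int[lebesgue_tuple p]_(t in slice (B `\` Bj) delta) (dens delta (tuple_rV t))%:E <=
   ((if S \subset delta then p%:R^-1 ^+ #|delta :\: S| else 0) *
    (2 * model_factor ^+ j.+1 * expR exponent_bound))%:E * integral_rV (dens S))%E.
Proof.
have Y0 : 0 <= 2 * model_factor ^+ j.+1 * expR exponent_bound.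
  by rewrite !mulr_ge0 ?expR_ge0 ?exprn_ge0 ?model_factor_ge0.
have J0 : (0 <= integral_rV (dens S))%E.
  by apply: integral_rV_ge0 => x; exact: qp_density_ge0.
have [slice0|] := eqVneq (slice (B `\` Bj) delta) set0.
  rewrite slice0 integral_set0 mule_ge0// lee_fin mulr_ge0//.
  by case: ifP => // _; rewrite exprn_ge0// invr_ge0.
move=> /set0P[t0 /slice_diff[Sd ds dj _]].
rewrite Sd.
have Sd' : (#|S| < #|delta|)%N by apply: leq_ltn_trans dj; exact: leq_addr.
have mA : measurable (slice (B `\` Bj) delta) by exact: (measurableD (mB delta) (mBj delta)).
have hA t : slice (B `\` Bj) delta t -> norm2 (restr delta (tuple_rV t) - thetas) <= C * eps.
  by move=> /slice_diff[_ _ _ []].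
have hd := data Sd ds; have hs := data (fintype.subxx _) S_le.
have := qp_mass_ratio rho0_gt0 rho1_gt0 omega_gt0 df mf C_ge3 eps_gt0 kappa_gt0
  a_ge0 curvature Sd hd hs mA hA.
move=> /le_trans; apply; apply: lee_wpmul2r => //; rewrite lee_fin.
set k := #|delta :\: S|.
have kE : (j.+1 <= k)%N.
  by rewrite /k cardsD (finset.setIidPr Sd) ltn_subRL.
have w := qp_weight_ratio rho0_gt0 rho1_gt0 q_gt0 q_lt1 kappa_gt0 Sd.
set W := qp_weight _ _ _ delta / _.
rewrite -/k /= -/W in w.
have mr := model_ratio_le p_gt0 rho1_gt0 kappa_gt0 q_odds kappa_large kE (gain Sd ds Sd').
rewrite -w -/model_factor in mr.
have Ce : C * eps <= `|thetas|.
  have [i iS] : exists i, i \in S by apply/card_gt0P.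
  by apply: (le_trans (ltW (beta_min iS))); exact: ler_coord_norm.
have er := total_error_le (delta := delta) rho1_gt0 C_ge3 eps_gt0 kappa_gt0 a_ge0
  Ce S_gt0 S_le ds.
rewrite -/exponent_bound -ler_expR in er.
set E := expR (_ + _) in er *.
have AC (x1 x2 x3 x4 : R) : 2 * (x1 * x2) * x3 * x4 = 2 * ((x1 * x3 * x2) * x4).
  by rewrite -!mulrA; congr (_ * (_ * _)); rewrite mulrCA.
rewrite AC.
have -> : p%:R^-1 ^+ k * (2 * model_factor ^+ j.+1 * expR exponent_bound) =
   2 * ((p%:R^-1 ^+ k * model_factor ^+ j.+1) * expR exponent_bound).
  by rewrite -!mulrA mulrCA.
rewrite ler_wpM2l//; apply: ler_pM => //; last exact: expR_ge0.
rewrite mulr_ge0 ?expR_ge0// w exprn_ge0// mulr_ge0 ?sqrtr_ge0//.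
by rewrite divr_ge0 ?subr_ge0 ?ltW.
Qed.

(** The constant 8 is twice the bound 4 on [expR 1], which comes from the sum over
    supermodels; the factor 2 is the price of restricting the Gaussian integral of
    the true model to a ball. *)
Lemma posterior_miss_le :
  1 - post Bj <= 8 * expR exponent_bound * model_factor ^+ j.+1 + post (~` B).
Proof.
have M0 : (0 < mass setT)%E by case/andP: well_defined.
have Moo : (mass setT < +oo)%E by case/andP: well_defined.
have fin A : measurable_slices A -> mass A \is a fin_num.
  move=> mA; rewrite ge0_fin_numE ?qp_mass_ge0//.
  by apply: le_lt_trans Moo; exact: qp_mass_le.
have mBC : measurable_slices (~` B) by move=> d; apply: measurableC; exact: mB.
have Mfin : mass setT \is a fin_num by rewrite ge0_fin_numE ?qp_mass_ge0.
pose J := integral_rV (dens S).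
have J0 : (0 <= J)%E by apply: integral_rV_ge0 => x; exact: qp_density_ge0.
have JM : (J <= mass setT)%E by exact: qp_mass_setT_ge.
have Jfin : J \is a fin_num by rewrite ge0_fin_numE//; exact: le_lt_trans Moo.
pose Y := 2 * model_factor ^+ j.+1 * expR exponent_bound.
have Y0 : 0 <= Y by rewrite !mulr_ge0 ?expR_ge0 ?exprn_ge0 ?model_factor_ge0.
have sumle : (\sum_(delta : {set 'I_p}) \int[lebesgue_tuple p]_(t in slice (B `\` Bj) delta)
    (dens delta (tuple_rV t))%:E <= (4 * Y * fine J)%:E)%E.
  apply: (@le_trans _ _ (\sum_(delta : {set 'I_p})
     ((if S \subset delta then p%:R^-1 ^+ #|delta :\: S| else 0) * Y * fine J)%:E)%E).
    apply: lee_sum => delta _; rewrite EFinM fineK//.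
    exact: slice_mass_le.
  rewrite sumEFin lee_fin -mulr_suml ler_wpM2r ?fine_ge0//.
  rewrite -mulr_suml ler_wpM2r// -big_mkcond/=.
  exact: le_trans (sum_supermodels_le S) expR1_le4.
have split := qp_mass_split rho0 rho1 omega_ge0 mf mBj mB.
have := le_trans split (leeD (lexx _) sumle).
rewrite -(fineK Mfin) -(fineK (fin _ mBj)) -(fineK (fin _ mBC)) -!EFinD lee_fin.
have fM0 : 0 < fine (mass setT) by rewrite fine_gt0// M0 Moo.
have fJM : fine J <= fine (mass setT) by rewrite fine_le.
rewrite /quasi_post; set M := fine (mass setT) in fM0 fJM *.
set m1 := fine _; set m2 := fine _ => hM.
have hYJ : 4 * Y * fine J <= 4 * Y * M by rewrite ler_wpM2l// mulr_ge0.
have -> : 8 * expR exponent_bound * model_factor ^+ j.+1 = 4 * Y by rewrite /Y; lra.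
move: (4 * Y) hM hYJ => c hM hYJ.
rewrite -(ler_pM2r fM0) !mulrDl mulNr mul1r !divfK ?gt_eqF//.
rewrite lerBlDr addrC addrA [X in _ <= X]addrAC; apply: (le_trans hM).
by rewrite lerD2l.
Qed.

End selection.
(** * Model selection *)

Theorem theorem5 (R : realType) (C C1 u : R)
    (hC : 3 <= C) (hC1 : 3 <= C1) (hu : 0 < u) :
  exists2 C0 : R, 0 < C0 &
  forall (p : nat)
    (dZ : measure_display) (Z : measurableType dZ)
    (dz : {sigma_finite_measure set Z -> \bar R})
    (ell : 'rV[R]_p -> Z -> R)
    (ell_meas : measurable_fun [set: p.-tuple (measurableTypeR R) * Z]
                  (fun tz => ell (tuple_rV tz.1) tz.2))
    (ell_diff : forall z, times_differentiable 3 (ell ^~ z))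
    (rho0 rho1 : R) (rho0_gt0 : 0 < rho0) (rho1_gt0 : 0 < rho1)
    (dO : measure_display) (Omega : measurableType dO) (P : probability Omega R)
    (rZ : {mfun Omega >-> Z})
    (fstar : Z -> R) (fstar_meas : measurable_fun [set: Z] fstar)
    (fstar_ge0 : forall z, 0 <= fstar z)
    (rZ_density : forall A : set Z, measurable A ->
       distribution P rZ A = (\int[dz]_(z in A) (fstar z)%:E)%E)
    (thetas : 'rV[R]_p) (thetas_neq0 : thetas != 0)
    (rhobar kappabar : R) (rhobar_gt0 : 0 < rhobar) (kappabar_gt0 : 0 < kappabar)
    (q : R) (q_gt0 : 0 < q) (q_lt1 : q < 1)
    (omega : {set 'I_p} -> R)
    (omega_prior : forall delta, omega delta = bernoulli_prior q delta)
    (q_odds : q / (1 - q) = 1 / p%:R `^ (u + 1))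
    (event0_pos : (0 < P (rZ @^-1` event0 rho0 rho1 omega ell thetas rhobar kappabar))%E)
    (rho1_small : 32 * rho1 * `|thetas| <= rhobar)
    (p_ge9 : (9 <= p)%N)
    (p_large : 2 * expR (2 * rho1) <= p%:R `^ (u / 2))
    (sbar : nat) (sbar_ge : (#|supp thetas| <= sbar)%N)
    (r : R -> R) (r_rate : rate_function r)
    (thetahat : forall delta : {set 'I_p}, Z -> 'rV[R]_#|delta|)
    (thetahat_argmax : forall z delta,
       event1 rho0 rho1 omega ell thetas rhobar kappabar r sbar z ->
       models sbar delta ->
       is_argmax (fun w : 'rV[R]_#|delta| => ellsub ell w z) (thetahat delta z))
    (E : set Z) (E_meas : measurable E)
    (E_sub : E `<=` event2 rho0 rho1 omega ell thetas rhobar kappabar r sbar u thetahat)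
    (beta_min : forall i, i \in supp thetas ->
       (C%:E * rate_eps thetas rhobar r sbar < `|thetas 0 i|%:E)%E)
    (kappa : R) (kappa_gt0 : 0 < kappa),
  let eps := fine (rate_eps thetas rhobar r sbar) in
  let post := quasi_post rho0 rho1 omega ell in
  let B := Ball rho0 thetas C C1 eps sbar in
  let Bj := Bsup rho0 thetas C C1 eps in
  let a := a2 ell thetas sbar thetahat ((C + 1) * eps) in
  (forall z, E z -> forall delta, supermodels thetas sbar delta ->
     forall w : 'rV[R]_#|delta|, norm2 (w - thetahat delta z) <= 2 * eps ->
     forall v : 'rV[R]_#|delta|, v != 0 ->
     kappa <= quadf (- hess (fun w' : 'rV[R]_#|delta| => ellsub ell w' z) w) v / norm2 v ^+ 2) ->
  (forall z, E z -> forall delta, supermodels thetas sbar delta ->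
     forall w : 'rV[R]_#|delta|,
     forall v : 'rV[R]_#|delta|, v != 0 ->
     quadf (- hess (fun w' : 'rV[R]_#|delta| => ellsub ell w' z) w) v / norm2 v ^+ 2 <= kappabar) ->
  4 * rho1 <= kappa * p%:R `^ u ->
  2 * (Num.sqrt #|supp thetas|%:R + 1) <= (C - 1) * eps * Num.sqrt kappa ->
  forall (j : nat) (z : Z), (1 <= j)%N ->
  ((\1_E z * (1 - post z (Bj j)))%:E <=
     8%:E *
     expeR (C0%:E * ((rho1 * `|thetas| * Num.sqrt sbar%:R * eps)%:E +
                     a z * (sbar%:R `^ (3 / 2) * eps ^+ 3)%:E)) *
     expeR (2%:E * a z * (sbar%:R ^+ 3 * eps / kappa)%:E) *
     ((Num.sqrt (rho1 / kappa) * (1 / p%:R `^ (u / 2))) ^+ j.+1)%:E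
   + (\1_E z * post z (~` B))%:E)%E.
Proof.
(* [(C + 1) ^+ 3] exceeds both the coefficient of the prior terms, at most [3 * C],
   and that of the two cubic remainders, each [(C + 1) ^+ 3 / 6] *)
exists ((C + 1) ^+ 3) => [|p dZ Z dz ell ell_meas ell_diff rho0 rho1 rho0_gt0 rho1_gt0
  dO Omega P rZ fstar _ _ _ thetas thetas_neq0 rhobar kappabar rhobar_gt0 _ q q_gt0
  q_lt1 omega omega_prior q_odds _ _ p_ge9 _ sbar sbar_ge r r_rate thetahat
  thetahat_argmax E _ E_sub beta_min kappa kappa_gt0].
  by rewrite exprn_gt0//; lra.
have omegaE : omega = bernoulli_prior q by apply/funext.
move=> eps post B Bj a curv _ kappa_large radius_large j z j1.
have eps_ge0 : 0 <= eps by rewrite fine_ge0// rate_eps_ge0.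
have S0 := card_supp_gt0 thetas_neq0.
have [i0 i0S] : exists i, i \in supp thetas by apply/card_gt0P.
have C0 : 0 < C by lra.
have eps_lty : (rate_eps thetas rhobar r sbar < +oo)%E.
  rewrite ltey; apply/eqP => epsE; have := beta_min i0 i0S.
  by rewrite epsE gt0_muley ?lte_fin.
have epsE : rate_eps thetas rhobar r sbar = eps%:E.
  by rewrite fineK// ge0_fin_numE// rate_eps_ge0.
have beta i : i \in supp thetas -> C * eps < `|thetas 0 i|.
  by move=> /beta_min; rewrite epsE -EFinM lte_fin.
have eps_gt0 : 0 < eps.
  rewrite lt_neqAle eps_ge0 andbT; apply: contraTneq radius_large => <-.
  by rewrite mulr0 mul0r -ltNge mulr_gt0// ltr_wpDl// sqrtr_ge0.
have thetas_gt0 : 0 < `|thetas| by rewrite normr_gt0.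
have sbar_gt0 : (0 < sbar)%N by exact: leq_trans sbar_ge.
have p_gt0 : (0 < p)%N by exact: leq_trans p_ge9.
have rad_ge0 : 0 <= (C + 1) * eps by rewrite mulr_ge0//; lra.
have a_ge0 : (0 <= a z)%E := a2_ge0 ell thetahat z thetas_neq0 sbar_ge rad_ge0.
have factor_gt0 : 0 < @model_factor R p rho1 u kappa.
  by rewrite mulr_gt0 ?sqrtr_gt0 ?divr_gt0// powR_gt0// ltr0n.
rewrite indicE; have [zE|zE] := boolP (z \in E); last first.
  by rewrite !mul0r adde0 !mule_ge0 ?expeR_ge0 ?lee_fin ?exprn_ge0// ltW.
rewrite (mul1r (1 - _)) (mul1r (post _ _)); move: zE; rewrite inE => zE.
have sbar_pow0 : 0 < sbar%:R `^ (3 / 2) * eps ^+ 3.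
  by rewrite mulr_gt0 ?exprn_gt0// powR_gt0// ltr0n.
have sbar_cub0 : 0 < sbar%:R ^+ 3 * eps / kappa.
  by rewrite divr_gt0// mulr_gt0// exprn_gt0// ltr0n.
have [aoo|afin] := eqVneq (a z) +oo%E.
  (* without a bound on the third derivatives the right-hand side is infinite *)
  have eoo : expeR (+oo : \bar R) = +oo%E by [].
  have C13 : 0 < (C + 1) ^+ 3 by rewrite exprn_gt0//; lra.
  rewrite aoo (gt0_mulye (x := (_ * eps ^+ 3)%:E)) ?lte_fin// addey//.
  rewrite (gt0_muley (x := ((C + 1) ^+ 3)%:E)) ?lte_fin// (gt0_muley (x := 2%:E)) ?lte_fin//.
  rewrite gt0_mulye ?lte_fin// eoo (gt0_muley (x := 8%:E)) ?lte_fin// mulyy.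
  by rewrite gt0_mulye ?lte_fin ?exprn_gt0// addye// leey.
have aE : a z = (fine (a z))%:E by rewrite fineK// ge0_fin_numE// ltey.
have fa_ge0 : 0 <= fine (a z) by rewrite fine_ge0.
have [ev1 ev2] := E_sub z zE.
have df := ell_diff z.
have mf : measurable_rV (ell ^~ z).
  have mpair : measurable_fun [set: p.-tuple (measurableTypeR R)]
      (fun t : p.-tuple (measurableTypeR R) => (t, z)).
    by apply/measurable_fun_pair; [exact: measurable_id|exact: measurable_cst].
  exact: measurableT_comp ell_meas mpair.
pose h (delta : {set 'I_p}) := embed (thetahat delta z).
have data (delta : {set 'I_p}) : supp thetas \subset delta -> (#|delta| <= sbar)%N ->
    local_maximum_data ell z thetas C eps kappa (fine (a z)) delta (h delta).
  move=> Sd ds.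
  have hmax : maximizes_on (ell ^~ z) delta (h delta).
    split; first exact: restr_embed.
    by move=> x /selectK <-; exact: thetahat_argmax.
  split=> //.
  - exact: maximizer_near_truth ev1 ds Sd hmax.
  - apply: (third_order_bound_a2 df (conj ds Sd)).
    by rewrite -aE.
  - apply: coercive_embed => // v v0; apply: (curv z zE delta) => //.
    by rewrite subrr -(scale0r (0 : 'rV_#|delta|)) norm2Z normr0 mul0r mulr_ge0.
have gain (delta : {set 'I_p}) : supp thetas \subset delta -> (#|delta| <= sbar)%N ->
    (#|supp thetas| < #|delta|)%N ->
    ell (h delta) z - ell (h (supp thetas)) z <=
    #|delta :\: supp thetas|%:R * u / 2 * ln p%:R.
  move=> Sd ds Slt.
  have kE : #|delta :\: supp thetas| = (#|delta| - #|supp thetas|)%N.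
    by rewrite cardsD (finset.setIidPr Sd).
  apply: (ev2 #|delta :\: supp thetas|) => //.
    by rewrite /= kE subn_gt0 Slt leq_sub2r.
  by rewrite kE subnKC// ltnW.
have wd : qp_well_defined rho0 rho1 (bernoulli_prior q) ell z.
  by rewrite -omegaE; case: ev1 => -[].
rewrite /post omegaE.
have := posterior_miss_le C1 j rho0_gt0 rho1_gt0 q_gt0 q_lt1 df mf hC eps_gt0 kappa_gt0
  fa_ge0 p_gt0 S0 sbar_ge beta q_odds kappa_large radius_large wd data gain.
rewrite -lee_fin => /le_trans; apply.
rewrite EFinD; apply: leeD => //.
move: (fine (a z)) aE => b ->.
set A := rho1 * _ * _ * eps; set V := _ `^ _ * _; set W := _ / kappa.
rewrite -[expeR (_ * (_ + _))]/((expR ((C + 1) ^+ 3 * (A + b * V)))%:E).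
rewrite -[expeR _]/((expR (2 * b * W))%:E) -!EFinM lee_fin.
by rewrite /exponent_bound -/A -/V -/W expRD mulrA.
Qed.
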